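(* Let $n\ge 1$ and $\gamma>0$. Let $F:B_1\times \mathrm{Sym}(n)\to\mathbb{R}$ be uniformly elliptic with constants $0<\lambda\le\Lambda<\infty$, with coefficients having modulus of continuity $\omega$ with constant $C_F$, with $F(x,0)=0$ for all $x\in B_1$, and convex or concave in the matrix variable. Let $\phi\in C^{1,1}(B_1)$ satisfy, for some constant $\Upsilon>0$, $|D\phi|^\gamma F(x,D^2\phi)\le-\Upsilon$ in $B_1$ in the viscosity sense. Let $u$ be a bounded viscosity solution to the $(F,\gamma,\phi,0)$-obstacle problem. Then, given $x_0\in\partial\{u>\phi\}\cap B_{1/2}$, there exists a universal constant $\mathfrak{c}>0$ such that $$\sup_{x\in\partial B_r(x_0)}(u(x)-\phi(x))\ge\mathfrak{c}\,r^{2}\qquad\text{for all }0<r<\tfrac12.$$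
   Context: $B_r(x_0)\subset\mathbb{R}^n$ is the open ball, $B_r=B_r(0)$; $\mathrm{Sym}(n)$ is the space of real symmetric $n\times n$ matrices. Uniform ellipticity: for all $x\in B_1$ and $X,Y\in\mathrm{Sym}(n)$, $\mathcal{M}^-_{\lambda,\Lambda}(X-Y)\le F(x,X)-F(x,Y)\le\mathcal{M}^+_{\lambda,\Lambda}(X-Y)$, where, with $e_i$ the eigenvalues of $X$, $\mathcal{M}^-_{\lambda,\Lambda}(X)=\lambda\sum_{e_i>0}e_i+\Lambda\sum_{e_i<0}e_i$ and $\mathcal{M}^+_{\lambda,\Lambda}(X)=\Lambda\sum_{e_i>0}e_i+\lambda\sum_{e_i<0}e_i$. Modulus of continuity of the coefficients: $\Theta_F(x,y):=\sup_{X\ne0}\frac{|F(x,X)-F(y,X)|}{\|X\|}\le C_F\,\omega(|x-y|)$ for $x,y\in B_1$, with $C_F>0$ a constant and $\omega$ a positive increasing function on $(0,\infty)$ with $\lim_{r\to0^+}\omega(r)=0$. Viscosity solutions: for $G:B_1\times\mathbb{R}^n\times\mathrm{Sym}(n)\to\mathbb{R}$ continuous and nondecreasing in the matrix variable, and $h$ continuous, $w\in C^0(B_1)$ is a viscosity supersolution (resp. subsolution) of $G(x,Dw,D^2w)=h(x)$ if whenever $\varphi\in C^2(B_1)$ and $w-\varphi$ has a local minimum (resp. maximum) at $x_0\in B_1$, then $G(x_0,D\varphi(x_0),D^2\varphi(x_0))\le h(x_0)$ (resp. $\ge h(x_0)$). A solution is both. ''$G(x,Dw,D^2w)\le h$ (resp.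 $\ge h$) in the viscosity sense'' means $w$ is a supersolution (resp. subsolution). $(F,\gamma,\phi,0)$-obstacle problem: $u\in C^0(\overline{B_1})$ is a viscosity solution if $|Du|^\gamma F(x,D^2u)=0$ in $B_1$ in the viscosity sense (the right-hand side $f\chi_{\{u>\phi\}}$ of the general problem vanishes because $f\equiv0$), $u\ge\phi$ in $B_1$, and $u=g$ on $\partial B_1$, where $g$ is a given continuous boundary datum with $\phi<g$ on $\partial B_1$. The free boundary $\partial\{u>\phi\}$ is the boundary in $B_1$ of $\{x\in B_1:u(x)>\phi(x)\}$. $\|w\|_{C^{1,1}(B_1)}=\|w\|_{L^\infty(B_1)}+\|Dw\|_{L^\infty(B_1)}+\sup_{x\ne y\in B_1}\frac{|w(x)-[w(y)+Dw(y)\cdot(x-y)]|}{|x-y|^{2}}$. ''Universal'' here means depending only on $n,\lambda,\Lambda,\gamma,C_F,\omega,\Upsilon$ and $\|\phi\|_{C^{1,1}(B_1)}$ (not on $u$, $x_0$, $r$). *)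

(* Defs.v *)
From HB Require Import structures.
From mathcomp Require Import all_boot all_order all_algebra.
From mathcomp Require Import all_classical all_reals all_analysis.

Set Implicit Arguments.
Unset Strict Implicit.
Unset Printing Implicit Defensive.

Import Order.TTheory GRing.Theory Num.Theory.
Import numFieldTopology.Exports numFieldNormedType.Exports.

Local Open Scope classical_set_scope.
Local Open Scope ring_scope.

(* R^n is 'rV[R]_n.  The norm and the `ball` that the library puts on matrices
   are those of the sup norm, so Euclidean versions are introduced here; the
   topology, hence `closure`, `interior`, continuity and `\near`, is the same
   for both norms. *)

Section Euclidean.
Variables (R : realType) (n : nat).

Definition dotp (u v : 'rV[R]_n) : R := \sum_(i < n) u 0 i * v 0 i.

Definition enorm (u : 'rV[R]_n) : R := Num.sqrt (dotp u u).

Definition eball (x0 : 'rV[R]_n) (r : R) : set 'rV[R]_n :=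
  [set x | enorm (x - x0) < r].

Definition bdry (A : set 'rV[R]_n) : set 'rV[R]_n := closure A `\` interior A.

Definition Sym : set 'M[R]_n := [set X | X^T = X].

(* The operator norm for the Euclidean norm; on symmetric matrices it does not
   matter that X acts on row vectors. *)
Definition opnorm (X : 'M[R]_n) : R :=
  sup [set enorm (v *m X) | v in [set v : 'rV[R]_n | enorm v = 1]].

End Euclidean.

Section Calculus.
Variables (R : realType) (n : nat).
Implicit Types (A : set 'rV[R]_n) (f w : 'rV[R]_n -> R).

Definition partial (i : 'I_n) f : 'rV[R]_n -> R :=
  fun x => 'D_(delta_mx 0 i) f x.

Definition grad f (x : 'rV[R]_n) : 'rV[R]_n := \row_i partial i f x.

Definition hess f (x : 'rV[R]_n) : 'M[R]_n :=
  \matrix_(i, j) partial j (partial i f) x.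

(* A is meant to be open in C1 and C2. *)
Definition C1 A f : Prop :=
  {within A, continuous f} /\
  forall i : 'I_n,
    (forall x, A x -> derivable f x (delta_mx 0 i)) /\
    {within A, continuous (partial i f)}.

Definition C2 A f : Prop := C1 A f /\ forall i : 'I_n, C1 A (partial i f).

(* The C^{1,1}(A) norm, possibly +oo.  It is used for w of class C^1, for which
   the L^oo norms of w and Dw on the open set A are suprema. *)
Definition C11norm A w : \bar R :=
  (ereal_sup [set (`|w x|)%:E | x in A]
   + ereal_sup [set (enorm (grad w x))%:E | x in A]
   + ereal_sup
       [set (`|w p.1 - (w p.2 + dotp (grad w p.2) (p.1 - p.2))|
               / enorm (p.1 - p.2) ^+ 2)%:E
       | p in [set p : 'rV[R]_n * 'rV[R]_n | [/\ A p.1, A p.2 & p.1 != p.2]]]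
  )%E.

Definition C11 A w : Prop := C1 A w /\ (C11norm A w < +oo)%E.

End Calculus.

Section Operators.
Variables (R : realType) (n : nat).
Implicit Types (X Y : 'M[R]_n) (F : 'rV[R]_n -> 'M[R]_n -> R).

(* Eigenvalues are counted with multiplicity: `mup e p` is the multiplicity of
   e as a root of p. *)
Definition sum_pos_eigen X : R :=
  \sum_(e \in [set e : R | eigenvalue X e /\ 0 < e]) e *+ mup e (char_poly X).

Definition sum_neg_eigen X : R :=
  \sum_(e \in [set e : R | eigenvalue X e /\ e < 0]) e *+ mup e (char_poly X).

Definition pucci_minus (lam Lam : R) X : R :=
  lam * sum_pos_eigen X + Lam * sum_neg_eigen X.

Definition pucci_plus (lam Lam : R) X : R :=
  Lam * sum_pos_eigen X + lam * sum_neg_eigen X.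

(* F : B_1 x Sym(n) -> R is represented by a function on all points and all
   matrices, of which only the values on B_1 x Sym(n) are ever constrained. *)
Definition uniformly_elliptic (lam Lam : R) F : Prop :=
  forall x, eball 0 1 x -> forall X Y, Sym X -> Sym Y ->
    pucci_minus lam Lam (X - Y) <= F x X - F x Y <= pucci_plus lam Lam (X - Y).

Definition Theta F (x y : 'rV[R]_n) : \bar R :=
  ereal_sup [set (`|F x X - F y X| / opnorm X)%:E
            | X in [set X : 'M[R]_n | Sym X /\ X != 0]].

(* The modulus omega lives on (0, +oo), hence x != y; Theta F x x is 0. *)
Definition coeff_modulus (CF : R) (omega : R -> R) F : Prop :=
  forall x y, eball 0 1 x -> eball 0 1 y -> x != y ->
    (Theta F x y <= (CF * omega (enorm (x - y)))%:E)%E.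

Definition is_modulus (omega : R -> R) : Prop :=
  [/\ forall r, 0 < r -> 0 < omega r,
      forall r s, 0 < r -> r <= s -> omega r <= omega s &
      omega r @[r --> 0^'+] --> (0 : R)].

Definition convex_on_Sym (f : 'M[R]_n -> R) : Prop :=
  forall X Y (t : R), Sym X -> Sym Y -> 0 <= t <= 1 ->
    f (t *: X + (1 - t) *: Y) <= t * f X + (1 - t) * f Y.

Definition concave_on_Sym (f : 'M[R]_n -> R) : Prop :=
  forall X Y (t : R), Sym X -> Sym Y -> 0 <= t <= 1 ->
    t * f X + (1 - t) * f Y <= f (t *: X + (1 - t) *: Y).

End Operators.

Section Viscosity.
Variables (R : realType) (n : nat).
Implicit Types (G : 'rV[R]_n -> 'rV[R]_n -> 'M[R]_n -> R)
  (F : 'rV[R]_n -> 'M[R]_n -> R) (h w phi g u : 'rV[R]_n -> R).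

Definition local_min w (x0 : 'rV[R]_n) : Prop := \forall y \near x0, w x0 <= w y.

Definition local_max w (x0 : 'rV[R]_n) : Prop := \forall y \near x0, w y <= w x0.

(* G(x, Dw, D^2 w) <= h(x) in B_1 *)
Definition visc_supersol G h w : Prop :=
  {within eball 0 1, continuous w} /\
  forall f, C2 (eball 0 1) f ->
  forall x0, eball 0 1 x0 -> local_min (w \- f) x0 ->
    G x0 (grad f x0) (hess f x0) <= h x0.

(* G(x, Dw, D^2 w) >= h(x) in B_1 *)
Definition visc_subsol G h w : Prop :=
  {within eball 0 1, continuous w} /\
  forall f, C2 (eball 0 1) f ->
  forall x0, eball 0 1 x0 -> local_max (w \- f) x0 ->
    h x0 <= G x0 (grad f x0) (hess f x0).

Definition visc_sol G h w : Prop := visc_supersol G h w /\ visc_subsol G h w.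

Definition degenerate (gamma : R) F :
    'rV[R]_n -> 'rV[R]_n -> 'M[R]_n -> R :=
  fun x p X => enorm p `^ gamma * F x X.

(* Viscosity solutions of the (F, gamma, phi, 0)-obstacle problem with boundary
   datum g. *)
Definition obstacle_sol F (gamma : R) phi g u : Prop :=
  [/\ {within closure (eball 0 1), continuous u},
      visc_sol (degenerate gamma F) (fun=> 0) u,
      forall x, eball 0 1 x -> phi x <= u x &
      forall x, bdry (eball 0 1) x -> u x = g x].

Definition free_boundary phi u : set 'rV[R]_n :=
  eball 0 1 `&` bdry [set x | eball 0 1 x /\ phi x < u x].

End Viscosity.

(* Main.v *)
Require Import Defs.
From HB Require Import structures.
From mathcomp Require Import all_boot all_order all_algebra.
From mathcomp Require Import all_classical all_reals all_analysis.
From mathcomp Require Import ring lra zify.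

Import Order.TTheory GRing.Theory Num.Theory.
Import numFieldTopology.Exports numFieldNormedType.Exports.

Set Implicit Arguments.
Unset Strict Implicit.
Unset Printing Implicit Defensive.

(* If the growth fails at [r], pick [y0] near [x0] with [u y0 > phi y0]: then
   [u - phi - c |x - y0|^2] has an interior maximum [z] in the ball, so that
   [psi = phi + c |x - y0|^2 + c |x - z|^2] touches [u] strictly from above at
   [z].  For small universal [c], [psi] is a strict supersolution with gradient
   bounded away from 0, because testing [phi] with its tangent paraboloid from
   below bounds [|D phi|] from below.

   The contradiction is a comparison principle for a continuous subsolution
   [u] and a C^{1,1} strict supersolution [psi].  For small slopes [p] let
   [(x_p, y_p)] maximise [u y - k |x - y|^2 - psi x - p . x]; the penalisation
   makes [p] a Lipschitz function of [x_p], so the points [x_p] fill a fixed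
   proportion of the cells of every fine enough grid.  Instead of Rademacher's
   or Alexandrov's theorem, a quantitative differentiation argument (box
   averages of difference quotients have monotone energies, which must
   stabilise at some scale) shows that at some arbitrarily small scale [h] the
   gradient of [psi] is [tau h]-close to an affine map around most grid points,
   hence around some [x_p].  There [psi] is [tau h^2]-close to one quadratic
   polynomial, and perturbations of it by [t |v|^2 / 2] with opposite signs
   touch [u] from above near [y_p] and [psi] from below near [x_p]. *)

Local Open Scope ring_scope.

(** * Quantitative differentiation on finite abelian groups *)

Section QD.
Variables (R : realFieldType) (V : finZmodType).

Lemma sum_shift (f : V -> R) (y : V) : \sum_x f (x + y) = \sum_x f x.
Proof. by rewrite [RHS](reindex_inj (addIr y)). Qed.

(** Expanding the square at each [x] leaves the mean square minus the square of the mean; summed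
    over the group, every offset contributes the same [\sum_x g x ^+ 2], by translation
    invariance. *)
Lemma variance_shift (A : finType) (o : A -> V) (g : V -> R) :
  (0 < #|A|)%N ->
  let gb x := #|A|%:R^-1 * \sum_a g (x + o a) in
  \sum_x \sum_a (g (x + o a) - gb x) ^+ 2
    = #|A|%:R * (\sum_x g x ^+ 2 - \sum_x gb x ^+ 2).
Proof.
move=> A0 gb; have A0' : #|A|%:R != 0 :> R by rewrite pnatr_eq0 -lt0n.
have key x : \sum_a (g (x + o a) - gb x) ^+ 2 =
  \sum_a g (x + o a) ^+ 2 - #|A|%:R * gb x ^+ 2.
  have E : \sum_a g (x + o a) = #|A|%:R * gb x by rewrite /gb mulrA divff ?mul1r.
  rewrite (eq_bigr (fun a => g (x + o a) ^+ 2 - 2 * gb x * g (x + o a) + gb x ^+ 2));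
    last by move=> a _; ring.
  rewrite big_split /= sumrB -mulr_sumr E sumr_const -mulr_natl.
  set c := #|A|%:R; ring.
rewrite (eq_bigr _ (fun x _ => key x)) sumrB exchange_big /= mulrBr -mulr_sumr.
rewrite (eq_bigr (fun=> \sum_x g x ^+ 2)); last first.
  by move=> a _; rewrite (sum_shift (fun x => g x ^+ 2)).
by rewrite sumr_const; congr (_ - _); rewrite mulr_natl.
Qed.

(** The [K] drops telescope to at most [E 0], since [E] stays nonnegative, so they cannot all exceed
    the average [E 0 / K]. *)
Lemma small_drop (E : nat -> R) (K : nat) :
  (0 < K)%N -> (forall k, 0 <= E k) ->
  exists2 k, (k < K)%N & (E k - E k.+1) * K%:R <= E 0%N.
Proof.
move=> K0 E0.
suff: [exists k : 'I_K, (E k - E k.+1) * K%:R <= E 0%N].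
  by move=> /existsP[k Hk]; exists k => //; apply: ltn_ord.
apply: contraT => /existsPn H; exfalso.
have: \sum_(k < K) (E k - E k.+1) * K%:R > \sum_(k < K) E 0%N.
  apply: ltr_sum => [|k _]; last by rewrite ltNge; apply: H.
  by apply/hasP; exists (Ordinal K0) => //; rewrite mem_index_enum.
rewrite -mulr_suml sumr_const card_ord -mulr_natr.
rewrite -(big_mkord xpredT (fun k => E k - E k.+1)).
rewrite -[X in _ < X]opprK -mulNr -sumrN.
under eq_bigr do rewrite opprB.
rewrite telescope_sumr // ltNge => /negP; apply; rewrite -mulNr.
rewrite mul1r -[X in _ <= X]mulr_natr ler_wpM2r ?ler0n //.
by rewrite opprB lerBlDr lerDl.
Qed.

Section Boxes.
Variables (n : nat) (e : 'I_n -> V) (M : nat).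
Implicit Types (f g : V -> R) (x y : V) (k : nat).

Definition lattice_vec (a : {ffun 'I_n -> 'I_M}) : V := \sum_i e i *+ a i.

(** Reading offsets by their base-[M] digits, this is the mean of [f] over the box of side [M ^ k]
    with corner [x] spanned by the [e i]. *)
Fixpoint box_avg k f x : R :=
  if k is k'.+1 then
    (#|{ffun 'I_n -> 'I_M}|%:R)^-1
      * \sum_a box_avg k' f (x + lattice_vec a *+ M ^ k')
  else f x.

(** The difference quotient and its averaging box have the same length [M ^ k]; this matching makes
    each scale an average of the previous one. *)
Definition box_diff k (j : 'I_n) f x : R :=
  box_avg k (fun y => f (y + e j *+ M ^ k) - f y) x / (M ^ k)%:R.

Hypothesis M0 : (0 < M)%N.

Let cardA : (0 < #|{ffun 'I_n -> 'I_M}|)%N.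
Proof. by rewrite card_ffun !card_ord expn_gt0 M0. Qed.

Lemma box_avg_shift k f x y : box_avg k (fun t => f (t + y)) x = box_avg k f (x + y).
Proof.
elim: k x => [//|k IH] x /=; congr (_ * _); apply: eq_bigr => a _.
by rewrite IH addrAC.
Qed.

Lemma box_avg_sum k (I : Type) (r : seq I) (F : I -> V -> R) x :
  box_avg k (fun t => \sum_(i <- r) F i t) x = \sum_(i <- r) box_avg k (F i) x.
Proof.
elim: k x => [//|k IH] x /=; rewrite -mulr_sumr exchange_big /=.
by congr (_ * _); apply: eq_bigr => a _.
Qed.

Lemma box_avgB k f g x :
  box_avg k (fun t => f t - g t) x = box_avg k f x - box_avg k g x.
Proof.
elim: k x => [//|k IH] x /=; rewrite -mulrBr -sumrB.
by congr (_ * _); apply: eq_bigr => a _.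
Qed.

Lemma eq_box_avg k f g x : f =1 g -> box_avg k f x = box_avg k g x.
Proof.
by move=> E; elim: k x => [//|k IH] x /=; congr (_ * _); apply: eq_bigr.
Qed.

Lemma avg_le (A : finType) (F : A -> R) (C : R) : (0 < #|A|)%N ->
  (forall a, `|F a| <= C) -> `|#|A|%:R^-1 * \sum_a F a| <= C.
Proof.
move=> A0 H; rewrite normrM normfV normr_nat ler_pdivrMl ?ltr0n //.
apply: le_trans (ler_norm_sum _ _ _) _.
by apply: le_trans (ler_sum _ (fun a _ => H a)) _; rewrite sumr_const mulr_natl.
Qed.

Lemma box_avg_le k f C x : (forall y, `|f y| <= C) -> `|box_avg k f x| <= C.
Proof. by move=> H; elim: k x => [//|k IH] x /=; apply: avg_le. Qed.

Lemma walk_le f x (y : V) c m : (forall x, `|f (x + y) - f x| <= c) ->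
  `|f (x + y *+ m) - f x| <= m%:R * c.
Proof.
move=> H; elim: m => [|m IH]; first by rewrite mulr0n addr0 subrr normr0 mul0r.
rewrite mulrSr addrA -[X in `|X|](subrKA (f (x + y *+ m))).
rewrite (le_trans (ler_normD _ _)) // -natr1 mulrDl mul1r [X in X <= _]addrC.
by rewrite lerD.
Qed.

Lemma lattice_walk f x (a : {ffun 'I_n -> 'I_M}) k :
  (forall x j, `|f (x + e j) - f x| <= 1) ->
  `|f (x + lattice_vec a *+ M ^ k) - f x| <= (n * M.-1 * M ^ k)%:R.
Proof.
move=> H; rewrite /lattice_vec -sumrMnl.
have gen (r : seq 'I_n) : `|f (x + \sum_(j <- r) e j *+ a j *+ M ^ k) - f x|
    <= (size r * M.-1 * M ^ k)%:R.
  elim: r x => [|j r IH] x; first by rewrite big_nil addr0 subrr normr0.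
  rewrite big_cons addrA -[X in `|X|](subrKA (f (x + e j *+ a j *+ M ^ k))).
  apply: (le_trans (ler_normD _ _)); rewrite /= mulSn mulnDl natrD [X in X <= _]addrC.
  apply: lerD; last exact: IH.
  rewrite -mulrnA; apply: le_trans (walk_le _ _ (fun x => H x j)) _.
  by rewrite mulr1 ler_nat leq_mul2r -ltnS prednK // ltn_ord orbT.
by have := gen (enum 'I_n); rewrite size_enum_ord big_enum.
Qed.

Lemma box_avg_close k f x : (forall x j, `|f (x + e j) - f x| <= 1) ->
  `|box_avg k f x - f x| <= (n * M ^ k)%:R.
Proof.
(* The sharper bound [n * (M ^ k - 1)] is the one stable under induction: a lattice step adds
   [n * (M - 1) * M ^ k], and the sum is [n * (M ^ k.+1 - 1)]. *)
move=> H; apply: (@le_trans _ _ (n * (M ^ k).-1)%:R); last first.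
  by rewrite ler_nat leq_mul2l leq_pred orbT.
elim: k x => [|k IH] x /=; first by rewrite subrr normr0.
have -> : f x = (#|{ffun 'I_n -> 'I_M}|%:R)^-1 * \sum_(a : {ffun 'I_n -> 'I_M}) f x.
  by rewrite sumr_const -[X in _ * X]mulr_natl mulKf // pnatr_eq0 -lt0n.
rewrite -mulrBr -sumrB; apply: avg_le => // a.
rewrite -[X in `|X|](subrKA (f (x + lattice_vec a *+ M ^ k))).
apply: le_trans (ler_normD _ _) _.
apply: le_trans (lerD (IH _) (lattice_walk _ _ _ H)) _.
rewrite -natrD ler_nat -mulnA -mulnDr leq_mul2l.
have := expn_gt0 M k; rewrite M0 /= => ek.
apply/orP; right; rewrite expnS; move: (M ^ k)%N ek => X X0.
rewrite -[in leqRHS](prednK M0) mulSn.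
by rewrite -[in leqRHS](prednK X0) addSn /= prednK.
Qed.

Lemma box_diff_le k j f x : (forall x j, `|f (x + e j) - f x| <= 1) ->
  `|box_diff k j f x| <= 1.
Proof.
move=> H; have ek : (0 < M ^ k)%N by rewrite expn_gt0 M0.
rewrite normrM normfV normr_nat ler_pdivrMr ?ltr0n // mul1r.
by apply: box_avg_le => y; rewrite (le_trans (walk_le _ _ (fun x => H x j))) ?mulr1.
Qed.

(** Offsets from scale [k] to [k.+1]: the top digits of the larger box, plus the starting places of
    the [M] short steps that make up one long step in direction [j]. *)
Definition tube_vec k j (a : {ffun 'I_n -> 'I_M} * 'I_M) : V :=
  (lattice_vec a.1 + e j *+ a.2) *+ M ^ k.

(* Each scale averages translates of the finer one, so by [variance_shift] the
   energies [\sum_x box_diff k j f x ^+ 2] decrease in [k] and their drop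
   controls the oscillation of [box_diff k] inside a box of the next scale. *)
Lemma box_diffS k j f x : box_diff k.+1 j f x =
  (#|{: {ffun 'I_n -> 'I_M} * 'I_M}|%:R)^-1
     * \sum_a box_diff k j f (x + tube_vec k j a).
Proof.
have ek : (M ^ k)%:R != 0 :> R by rewrite pnatr_eq0 -lt0n expn_gt0 M0.
have eM : M%:R != 0 :> R by rewrite pnatr_eq0 -lt0n M0.
(* A step of length [M ^ k.+1] is a chain of [M] steps of length [M ^ k]. *)
have telS y : f (y + e j *+ M ^ k.+1) - f y =
  \sum_(r < M) (f (y + e j *+ (r * M ^ k) + e j *+ M ^ k) - f (y + e j *+ (r * M ^ k))).
  rewrite -(big_mkord xpredT (fun r =>
    f (y + e j *+ (r * M ^ k) + e j *+ M ^ k) - f (y + e j *+ (r * M ^ k)))).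
  rewrite (eq_bigr (fun r => f (y + e j *+ (r.+1 * M ^ k)) - f (y + e j *+ (r * M ^ k)))).
    by rewrite telescope_sumr // mul0n mulr0n addr0 expnS.
  by move=> r _; rewrite -addrA -mulrnDr mulSn [(M ^ k + _)%N]addnC.
rewrite /box_diff (eq_box_avg _ _ telS) box_avg_sum /=.
rewrite card_prod card_ord natrM expnS natrM !invfM -mulr_suml.
have -> : \sum_(r < M) box_avg k.+1
   (fun t => f (t + e j *+ (r * M ^ k) + e j *+ M ^ k) - f (t + e j *+ (r * M ^ k))) x =
   #|{ffun 'I_n -> 'I_M}|%:R^-1 * \sum_(i : {ffun 'I_n -> 'I_M} * 'I_M)
      box_avg k (fun y => f (y + e j *+ M ^ k) - f y) (x + tube_vec k j i).
  rewrite /= -mulr_sumr; congr (_ * _); rewrite exchange_big /=.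
  rewrite (pair_bigA _ (fun a r => box_avg k _ (x + lattice_vec a *+ M ^ k))) /=.
  apply: eq_bigr => -[a r] _ /=.
  rewrite (box_avg_shift k (fun y => f (y + e j *+ M ^ k) - f y)).
  by rewrite /tube_vec /= mulrnDl addrA -mulrnA.
set S := \sum_i _; by rewrite [in RHS]mulrA; ring.
Qed.

Lemma box_avg_step k j f x :
  box_avg k f (x + e j *+ M ^ k) - box_avg k f x = (M ^ k)%:R * box_diff k j f x.
Proof.
have ek : (M ^ k)%:R != 0 :> R by rewrite pnatr_eq0 -lt0n expn_gt0 M0.
by rewrite /box_diff box_avgB box_avg_shift mulrC divfK.
Qed.

(** The lattice point is reached from [x] by at most [n * M] steps [e j *+ M ^ k]; by [box_avg_step]
    each changes the average by [M ^ k] times a difference quotient that is [sigma]-close to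
    [A j]. *)
Lemma box_avg_affine k f (A : 'I_n -> R) sigma x : 0 <= sigma ->
  (forall j a, `|box_diff k j f (x + tube_vec k j a) - A j| <= sigma) ->
  forall a : {ffun 'I_n -> 'I_M},
  `|box_avg k f (x + lattice_vec a *+ M ^ k) - box_avg k f x
      - (M ^ k)%:R * \sum_j (a j)%:R * A j| <= (M ^ k)%:R * ((n * M)%:R * sigma).
Proof.
move=> s0 H a.
(* Induction on the sum of the coordinates, which keeps every intermediate point of the form
   [x + lattice_vec b *+ M ^ k]. *)
have gen N : forall a : {ffun 'I_n -> 'I_M}, (\sum_j a j = N)%N ->
  `|box_avg k f (x + lattice_vec a *+ M ^ k) - box_avg k f x
      - (M ^ k)%:R * \sum_j (a j)%:R * A j| <= (M ^ k)%:R * (N%:R * sigma).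
  elim: N => [|N IH] {}a aN.
    have a0 j : a j = 0 :> nat.
      by apply/eqP; move/eqP: aN; rewrite sum_nat_eq0 => /forallP/(_ j).
    have -> : lattice_vec a = 0 by rewrite /lattice_vec big1 // => j _; rewrite a0.
    rewrite [\sum_j _]big1; last by move=> j _; rewrite a0 mul0r.
    by rewrite mul0rn addr0 subrr mulr0 subr0 normr0 mul0r mulr0.
  have [j aj] : exists j, (0 < a j)%N.
    apply/existsP; apply: contraT => /existsPn a0.
    by move: aN; rewrite big1 // => j _; apply/eqP; rewrite -leqn0 leqNgt.
  have pM : ((a j).-1 < M)%N by rewrite (leq_ltn_trans (leq_pred _)).
  pose b : {ffun 'I_n -> 'I_M} :=
    [ffun i => if i == j then Ordinal pM else a i].
  have bE i : a i = (b i + (i == j))%N :> nat.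
    by rewrite ffunE; case: eqP => [->|_] /=; rewrite ?addn1 ?prednK ?addn0.
  have ind1 : (\sum_i (i == j) = 1)%N.
    by rewrite (bigD1 j) //= eqxx big1 ?addn0 // => i /negPf ->.
  have bN : (\sum_i b i = N)%N.
    apply/eqP; rewrite -eqSS -aN (eq_bigr _ (fun i _ => bE i)) big_split /=.
    by rewrite ind1 addn1.
  have va : lattice_vec a = lattice_vec b + e j.
    rewrite /lattice_vec (eq_bigr (fun i => e i *+ b i + e i *+ (i == j))); last first.
      by move=> i _; rewrite bE mulrnDr.
    rewrite big_split /=; congr (_ + _).
    by rewrite (bigD1 j) //= eqxx big1 ?addr0 // => i /negPf ->.
  have sa : \sum_i (a i)%:R * A i = \sum_i (b i)%:R * A i + A j.
    rewrite (eq_bigr (fun i => (b i)%:R * A i + (i == j)%:R * A i)); last first.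
      by move=> i _; rewrite bE natrD mulrDl.
    rewrite big_split /=; congr (_ + _).
    by rewrite (bigD1 j) //= eqxx mul1r big1 ?addr0 // => i /negPf ->; rewrite mul0r.
  have := H j (b, Ordinal M0); rewrite {1}/tube_vec /= mulr0n addr0 => Hj.
  have st := box_avg_step k j f (x + lattice_vec b *+ M ^ k).
  rewrite va sa mulrnDl addrA.
  rewrite -[box_avg k f (_ + e j *+ _)](subrK (box_avg k f (x + lattice_vec b *+ M ^ k))) st.
  set T := box_diff _ _ _ _ in Hj *; set S := \sum_i _.
  have -> : (M ^ k)%:R * T + box_avg k f (x + lattice_vec b *+ M ^ k)
      - box_avg k f x - (M ^ k)%:R * (S + A j) = (M ^ k)%:R * (T - A j) +
    (box_avg k f (x + lattice_vec b *+ M ^ k) - box_avg k f x - (M ^ k)%:R * S).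
    by ring.
  rewrite (le_trans (ler_normD _ _)) // -natr1 mulrDl mul1r mulrDr [X in _ <= X]addrC.
  by rewrite lerD ?IH // normrM normr_nat ler_wpM2l.
apply: le_trans (gen _ a erefl) _.
rewrite ler_wpM2l // ler_wpM2r // ler_nat.
apply: (@leq_trans (\sum_(j < n) M)); last by rewrite sum_nat_const card_ord.
by apply: leq_sum => j _; apply/ltnW/ltn_ord.
Qed.

(** The energy starts at most at [m * n * #|V|], so some scale loses at most a fraction [1 / K] of
    that. By [variance_shift] the loss controls a sum of variances, and Chebyshev's inequality
    bounds the number of points where some quotient deviates by more than [sigma]. Elsewhere
    [box_avg_affine] applies, and replacing averages by values of [f] costs [n * M ^ k] at each of
    the two endpoints. *)
Lemma quantitative_differentiation (m K : nat) (sigma : R) (f : 'I_m -> V -> R) :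
  (0 < K)%N -> 0 < sigma ->
  (forall i x j, `|f i (x + e j) - f i x| <= 1) ->
  exists2 k, (k < K)%N & exists2 bad : {set V},
    #|bad|%:R * (sigma ^+ 2 * K%:R) <= (m * n * (M ^ n * M) * #|V|)%:R &
    forall x, x \notin bad -> exists2 A : 'I_m -> 'I_n -> R,
      forall i j, `|A i j| <= 1 &
      forall (a : {ffun 'I_n -> 'I_M}) i,
        `|f i (x + lattice_vec a *+ M ^ k) - f i x
            - (M ^ k)%:R * \sum_j (a j)%:R * A i j|
        <= (M ^ k)%:R * ((n * M)%:R * sigma + (2 * n)%:R).
Proof.
move=> K0 s0 H.
pose E k := \sum_i \sum_j \sum_x box_diff k j (f i) x ^+ 2.
have E0 k : 0 <= E k by do 3 (apply: sumr_ge0 => ? _); apply: sqr_ge0.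
have [k kK dE] := small_drop K0 E0; exists k => //.
have EV : E 0%N <= (m * n * #|V|)%:R.
  rewrite /E -mulnA natrM mulr_natl -[X in _ *+ X]card_ord -sumr_const.
  apply: ler_sum => i _.
  rewrite natrM mulr_natl -[X in _ *+ X]card_ord -sumr_const.
  apply: ler_sum => j _; rewrite -sumr_const; apply: ler_sum => x _.
  by rewrite -[leRHS](expr1n _ 2) -[leLHS]real_normK ?num_real // lerXn2r ?nnegrE // box_diff_le.
set A := (({ffun 'I_n -> 'I_M} * 'I_M)%type : finType).
have cA : #|A| = (M ^ n * M)%N by rewrite card_prod card_ffun !card_ord.
pose D i j x a := box_diff k j (f i) (x + tube_vec k j a) - box_diff k.+1 j (f i) x.
have DE : \sum_x \sum_i \sum_j \sum_(a : A) D i j x a ^+ 2 = #|A|%:R * (E k - E k.+1).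
  rewrite exchange_big /= /E -sumrB mulr_sumr; apply: eq_bigr => i _.
  rewrite exchange_big /= -sumrB mulr_sumr; apply: eq_bigr => j _.
  rewrite (eq_bigr (F1 := fun x => box_diff k.+1 j (f i) x ^+ 2) (fun x =>
    (#|A|%:R^-1 * \sum_(a : A) box_diff k j (f i) (x + tube_vec k j a)) ^+ 2)); last first.
    by move=> x _; rewrite box_diffS.
  rewrite -variance_shift; last by rewrite cA muln_gt0 expn_gt0 M0.
  by apply: eq_bigr => x _; apply: eq_bigr => a _; rewrite /D box_diffS.
exists [set x | [exists i, exists j, exists a : A, `|D i j x a| > sigma]].
  set bad := [set x | _].
  have badE : #|bad|%:R * sigma ^+ 2 <= #|A|%:R * (E k - E k.+1).
    rewrite -DE mulr_natl -sumr_const.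
    apply: (@le_trans _ _ (\sum_(x in bad) \sum_i \sum_j \sum_(a : A) D i j x a ^+ 2)).
      apply: ler_sum => x; rewrite inE => /existsP[i /existsP[j /existsP[a Ha]]].
      rewrite (bigD1 i) //= (bigD1 j) //= (bigD1 a) //=.
      rewrite -!addrA -[leLHS]addr0 lerD //.
        by rewrite -[leRHS]real_normK ?num_real // lerXn2r ?nnegrE // ltW.
      rewrite !addr_ge0 //; do 3?(apply: sumr_ge0 => ? _); exact: sqr_ge0.
    rewrite [leRHS](bigID (mem bad)) /= lerDl.
    by do 4 (apply: sumr_ge0 => ? _); apply: sqr_ge0.
  rewrite mulrA; apply: le_trans (ler_wpM2r (ler0n _ _) badE) _.
  rewrite -mulrA; apply: le_trans (ler_wpM2l (ler0n _ _) (le_trans dE EV)) _.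
  by rewrite -natrM ler_nat cA mulnCA mulnA.
move=> x; rewrite inE => /existsPn good.
(* The slopes are the quotients of the next scale, which are the means over the tube of those at
   scale [k]. *)
exists (fun i j => box_diff k.+1 j (f i) x) => [i j|a i]; first exact: box_diff_le.
have gd j b : `|D i j x b| <= sigma.
  have /existsPn/(_ j)/existsPn/(_ b) := good i.
  by rewrite -leNgt.
have := box_avg_affine (ltW s0) gd a.
set S := _ * \sum_j _ => B.
have C1 := box_avg_close k (x + lattice_vec a *+ M ^ k) (H i).
have C2 := box_avg_close k x (H i).
set Z := _ * sigma in B *.
have -> : (M ^ k)%:R * (Z + (2 * n)%:R) =
  (M ^ k)%:R * Z + ((n * M ^ k)%:R + (n * M ^ k)%:R) by rewrite !natrM; ring.
by move: B C1 C2; rewrite !ler_norml; lra.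
Qed.

End Boxes.
End QD.

Local Open Scope classical_set_scope.

(** * Contact points and grids *)

Section SupNorm.
Variables (R : realType) (n : nat).
Implicit Types (x y v : 'rV[R]_n) (c : R).

Lemma norm_coord x i : `|x 0 i| <= `|x|.
Proof.
rewrite [leRHS]/Num.norm /= mx_normrE.
by apply/bigmax_geP; right => /=; exists (0, i).
Qed.

Lemma norm_le x c : 0 <= c -> (forall i, `|x 0 i| <= c) -> `|x| <= c.
Proof.
move=> c0 H; rewrite [leLHS]/Num.norm /= mx_normrE.
by apply/bigmax_leP; split => //= -[i j] _ /=; rewrite ord1.
Qed.

Lemma coord_itv x c i : `|x| <= c -> - c <= x 0 i <= c.
Proof. by move=> /(le_trans (norm_coord _ i)); rewrite ler_norml. Qed.

Lemma coord_itvB x y c i : `|x - y| <= c -> - c <= x 0 i - y 0 i <= c.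
Proof. by move=> /(coord_itv i); rewrite !mxE. Qed.

Lemma sum_norm_le (F : 'I_n -> R) c : (forall i, `|F i| <= c) -> `|\sum_i F i| <= n%:R * c.
Proof.
move=> H; apply: le_trans (ler_norm_sum _ _ _) _.
by apply: le_trans (ler_sum _ (fun i _ => H i)) _; rewrite sumr_const card_ord mulr_natl.
Qed.

End SupNorm.

Section Grid.
Variables (R : realType) (n : nat) (z : 'rV[R]_n) (rho : R) (q : nat).
Hypothesis rho0 : 0 < rho.
Let s : R := 4 * rho / q.+1%:R.
Let V := 'rV['I_(q.*2.+2)]_n.

(* Folding the cyclic group over the box keeps Lipschitz functions Lipschitz, so
   that group averages meet no boundary. *)
Definition tent (x : 'I_(q.*2.+2)) : R := s * (minn x (q.*2.+2 - x))%:R.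

Definition grid_pos (x : V) : 'rV[R]_n := \row_i (z 0 i - 2 * rho + tent (x 0 i)).

Let s0 : 0 < s. Proof. by rewrite divr_gt0 ?mulr_gt0. Qed.

Let sq : s * q.+1%:R = 4 * rho. Proof. by rewrite divfK // pnatr_eq0. Qed.

Lemma tent_step x : `|tent (x + 1) - tent x| <= s.
Proof.
rewrite /tent -mulrBr normrM gtr0_norm // -[leRHS]mulr1 ler_pM2l //.
have [xl|xl] := ltnP x.+1 q.*2.+2.
  have -> : (x + 1 : 'I_(q.*2.+2)) = x.+1 :> nat.
    by rewrite /= modn_small ?addn1 // modn_small // addn1.

  have a1 : (minn x.+1 (q.*2.+2 - x.+1) <= (minn x (q.*2.+2 - x)).+1)%N by lia.
  have a2 : (minn x (q.*2.+2 - x) <= (minn x.+1 (q.*2.+2 - x.+1)).+1)%N by lia.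
  by move: a1 a2; rewrite -!(ler_nat R) -!natr1 ler_norml; lra.
(* The step that wraps around from the last index to 0, where the tent falls from [s] to 0. *)
have xE : x = q.*2.+1 :> nat by apply/eqP; rewrite eqn_leq -ltnS ltn_ord -ltnS.
have -> : (x + 1 : 'I_(q.*2.+2)) = 0%N :> nat.
  by rewrite /= xE [(1 %% _)%N]modn_small // addn1 modnn.
rewrite xE min0n; have -> : (q.*2.+2 - q.*2.+1 = 1)%N by lia.
have -> : (minn q.*2.+1 1 = 1)%N by lia.
by rewrite sub0r normrN normr1.
Qed.

Lemma tent_ge0 x : 0 <= tent x. Proof. by rewrite mulr_ge0 // ltW. Qed.

Lemma tent_le x : tent x <= 4 * rho.
Proof. by rewrite -sq ler_pM2l // ler_nat; have := ltn_ord x; lia. Qed.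

Lemma tent_small (x : 'I_(q.*2.+2)) : (x <= q.+1)%N -> tent x = s * x%:R.
Proof. by move=> xq; congr (_ * _%:R); lia. Qed.

Lemma grid_pos_box x : `|grid_pos x - z| <= 2 * rho.
Proof.
apply: norm_le => [|i]; first by rewrite mulr_ge0 // ltW.
rewrite !mxE; have := tent_ge0 (x 0 i); have := tent_le (x 0 i).
by rewrite ler_norml; lra.
Qed.

Let e (j : 'I_n) : V := delta_mx 0 j.

Lemma grid_pos_step x j : `|grid_pos (x + e j) - grid_pos x| <= s.
Proof.
apply: norm_le => [|i]; first exact: ltW.
rewrite !mxE eqxx /= opprD addrACA subrr add0r; case: (i == j); first exact: tent_step.
by rewrite addr0 subrr normr0 ltW.
Qed.

(** Up to index [q.+1] the tent is on its rising side and sums do not wrap around the cyclic group,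
    so a lattice translation becomes a Euclidean one. *)
Lemma grid_pos_lattice M (x : V) (a : {ffun 'I_n -> 'I_M}) m :
  (forall i, (x 0%R i + a i * m <= q.+1)%N) ->
  grid_pos (x + lattice_vec e a *+ m) = grid_pos x + \row_i (s * m%:R * (a i)%:R).
Proof.
move=> H; apply/rowP => i; rewrite [LHS]mxE [RHS]mxE ![in RHS]mxE.
have E : ((x + lattice_vec e a *+ m) 0 i = (x 0%R i + a i * m)%N :> nat).
  rewrite mxE; have -> : (lattice_vec e a *+ m) 0 i = (a i * m)%:R :> 'I_(q.*2.+2).
    rewrite mulmxnE summxE (bigD1 i) //= big1 ?addr0.
      by rewrite mulmxnE mxE !eqxx -mulrnA.
    by move=> j /negPf ji; rewrite mulmxnE mxE eqxx eq_sym ji mul0rn.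
  rewrite Zp_nat /=.
  by have h := H i; rewrite modnDmr modn_small // (leq_ltn_trans h) //; lia.
by rewrite !tent_small ?E ?(leq_trans (leq_addr _ _) (H i)) // natrD natrM; ring.
Qed.
End Grid.

Lemma exists_nat_gt (R : realType) (x : R) : exists m : nat, x < m%:R.
Proof. by exists (Num.trunc x).+1; apply: truncnS_gt. Qed.

Lemma trunc_div_itv (R : realType) (x s : R) : 0 < s -> 0 <= x ->
  s * (Num.trunc (x / s))%:R <= x < s * (Num.trunc (x / s))%:R + s.
Proof.
move=> s0 x0; have /andP[t1 t2] := truncn_itv (divr_ge0 x0 (ltW s0)).
rewrite mulrC -ler_pdivlMr // t1 /=.
by move: t2; rewrite ltr_pdivrMr // -natr1 mulrDl mul1r.
Qed.

(** * Approximate affinity of a Lipschitz map near a point of a large set *)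

Section ApproxAffine.
Variables (R : realType) (n : nat) (z : 'rV[R]_n) (rho L C delta : R).
Variables (G X : 'rV[R]_n -> 'rV[R]_n).
Hypotheses (rho0 : 0 < rho) (L0 : 0 < L) (C0 : 0 < C) (delta0 : 0 < delta).
Hypothesis lipG : forall x y, `|x - z| <= 2 * rho -> `|y - z| <= 2 * rho ->
  `|G x - G y| <= L * `|x - y|.
Hypothesis boxX : forall p, `|p| <= delta -> `|X p - z| <= rho.
Hypothesis invX : forall p p' t, `|p| <= delta -> `|p'| <= delta ->
  0 < t -> t <= rho -> `|X p - X p'| <= t -> `|p - p'| <= C * t.

Section Step.
Variables (q M k : nat) (sigma : R).
Let s : R := 4 * rho / q.+1%:R.
Let V := 'rV['I_(q.*2.+2)]_n.
Let h := (M.+1 ^ k.+1)%:R * s / 4.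
Let f (i : 'I_n) (x : V) := G (grid_pos z rho x) 0 i / (L * s).
Let e (j : 'I_n) : V := delta_mx 0 j.
Hypotheses (hrho : h <= rho) (M3 : (3 <= M)%N).

Let s0 : 0 < s. Proof. by rewrite divr_gt0 ?mulr_gt0. Qed.
Let sq : s * q.+1%:R = 4 * rho. Proof. by rewrite divfK // pnatr_eq0. Qed.
Let h0 : 0 < h. Proof. by rewrite divr_gt0 ?mulr_gt0 // ltr0n expn_gt0. Qed.

(* The shift by [h] puts all of [X p + v], [`|v| <= h], inside the box of side
   [4 * h] with this lower corner. *)
Definition corner (p : 'rV[R]_n) : V :=
  \row_i inord (Num.trunc ((X p 0 i - h - (z 0 i - 2 * rho)) / s)).

Lemma corner_itv p i : `|p| <= delta ->
  s * (corner p 0 i)%:R <= X p 0 i - h - (z 0 i - 2 * rho) < s * (corner p 0 i)%:R + s.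
Proof.
move=> pd; set y := _ - _ - _.
have Xi := coord_itvB i (boxX pd).
have y0 : 0 <= y by rewrite /y; have := hrho; lra.
have yq : y / s <= q.+1%:R.
  by rewrite ler_pdivrMr // mulrC sq /y; have := h0; lra.
have tq : (Num.trunc (y / s) <= q.+1)%N.
  by rewrite -(ler_nat R); apply: le_trans yq; rewrite truncn_le divr_ge0 // ltW.
rewrite mxE -/y inordK; last by rewrite ltnS (leq_trans tq) //; lia.
exact: trunc_div_itv.
Qed.

(** Slopes more than [C * s] apart thus have distinct corners, which is how the points [X p] are
    shown to fill a fixed proportion of the grid. *)
Lemma corner_inj p p' : s <= rho -> `|p| <= delta -> `|p'| <= delta ->
  corner p = corner p' -> `|p - p'| <= C * s.
Proof.
move=> sr pd pd' E; apply: invX => //; apply: norm_le => [|i]; first exact: ltW.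
have := corner_itv i pd; have := corner_itv i pd'; rewrite E !mxE.
by rewrite ler_norml; lra.
Qed.

Lemma grid_lip i x j : `|f i (x + e j) - f i x| <= 1.
Proof.
rewrite /f -mulrBl normrM normfV [`|L * s|]gtr0_norm ?mulr_gt0 // ler_pdivrMr ?mulr_gt0 // mul1r.
have -> : G (grid_pos z rho (x + e j)) 0 i - G (grid_pos z rho x) 0 i =
   (G (grid_pos z rho (x + e j)) - G (grid_pos z rho x)) 0 i by rewrite !mxE.
apply: le_trans (norm_coord _ _) _; apply: le_trans (lipG _ _) _.
- exact: grid_pos_box.
- exact: grid_pos_box.
by rewrite ler_wpM2l ?grid_pos_step // ltW.
Qed.

(** [X p + v] is rounded down to a lattice point of mesh [(M.+1 ^ k)%:R * s] above the corner. The
    rounding costs [L] times the mesh through [lipG] and [n] times as much through the linear part,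
    which turns [2 * n] into [3 * n + 1]. *)
Lemma corner_affine p (A : 'I_n -> 'I_n -> R) : `|p| <= delta ->
  (forall i j, `|A i j| <= 1) ->
  (forall (a : {ffun 'I_n -> 'I_M.+1}) i,
        `|f i (corner p + lattice_vec e a *+ M.+1 ^ k) - f i (corner p)
            - (M.+1 ^ k)%:R * \sum_j (a j)%:R * A i j|
        <= (M.+1 ^ k)%:R * ((n * M.+1)%:R * sigma + (2 * n)%:R)) ->
  forall v i, `|v| <= h ->
  `|G (X p + v) 0 i - G (grid_pos z rho (corner p)) 0 i
     - \sum_j (X p + v - grid_pos z rho (corner p)) 0 j * (L * A i j)|
  <= L * s * (M.+1 ^ k)%:R * ((n * M.+1)%:R * sigma + (3 * n).+1%:R).
Proof.
move=> pd A1 HA v i vh; set b := corner p in HA *; set m := (M.+1 ^ k)%N in HA *.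
have m0 : 0 < m%:R :> R by rewrite ltr0n expn_gt0.
have hE : h = M.+1%:R * (m%:R * s) / 4 by rewrite /h expnS natrM mulrA.
have ms0 : 0 < m%:R * s by rewrite mulr_gt0.
have M4 : 4 <= M.+1%:R :> R by rewrite (ler_nat R 4).
have m1 : 1 <= m%:R :> R by rewrite (ler_nat R 1) expn_gt0.
have sms : s <= m%:R * s by rewrite ler_peMl // ltW.
set w := X p + v - grid_pos z rho b.
have bq j : (b 0%R j <= q.+1)%N.
  rewrite -(ler_nat R) -(ler_pM2l s0) sq; have /andP[c1 _] := corner_itv j pd.
  have Xi := coord_itvB j (boxX pd).
  by apply: le_trans c1 _; have := h0; lra.
have wE j : w 0 j = X p 0 j + v 0 j - (z 0 j - 2 * rho) - s * (b 0 j)%:R.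
  have gb : grid_pos z rho b 0 j = z 0 j - 2 * rho + s * (b 0 j)%:R.
    by rewrite mxE tent_small.
  have wB : w 0 j = X p 0 j + v 0 j - grid_pos z rho b 0 j.
    by rewrite mxE [X in X + _]mxE [X in _ + X]mxE.
  by rewrite wB gb; ring.
have w_itv j : 0 <= w 0 j < M.+1%:R * (m%:R * s).
  have := corner_itv j pd; rewrite -/b.
  have := coord_itv j vh; rewrite wE.
  (* The box has side [4 * h]; the shift by [h], the vector [v] and the rounding of the corner use
     up at most [h + h + s], which fits because [M.+1 >= 4]. *)
  have : h + h + s < M.+1%:R * (m%:R * s).
    have : 4 * (m%:R * s) <= M.+1%:R * (m%:R * s) by rewrite ler_wpM2r // ltW.
    by rewrite hE; lra.
  by lra.
pose a : {ffun 'I_n -> 'I_M.+1} := [ffun j => inord (Num.trunc (w 0 j / (m%:R * s)))].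
have a_itv j : m%:R * s * (a j)%:R <= w 0 j < m%:R * s * (a j)%:R + m%:R * s.
  have /andP[w1 w2] := w_itv j.
  rewrite ffunE inordK; first exact: trunc_div_itv.
  by rewrite truncn_lt_nat ?divr_ge0 ?(ltW ms0) // ltr_pdivrMr.
have vb : `|X p + v - z| <= 2 * rho.
  rewrite addrAC (le_trans (ler_normD _ _)) //.
  by have := boxX pd; have := hrho; lra.
have posE : grid_pos z rho (b + lattice_vec e a *+ m) =
    grid_pos z rho b + \row_j (s * m%:R * (a j)%:R).
  apply: grid_pos_lattice => // j.
  rewrite -(ler_nat R) natrD natrM -(ler_pM2l s0) sq.
  have := a_itv j; rewrite wE.
  have := coord_itvB j vb; rewrite [X in _ <= X - _ <= _]mxE.
  rewrite mulrDr; have -> : s * ((a j)%:R * m%:R) = m%:R * s * (a j)%:R by ring.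
  by lra.
have d1 : `|X p + v - grid_pos z rho (b + lattice_vec e a *+ m)| <= m%:R * s.
  apply: norm_le => [|j]; first exact: ltW.
  rewrite posE opprD addrA -/w [X in `|X|]mxE; have := a_itv j.
  by rewrite !mxE [s * m%:R]mulrC ler_norml; lra.
have := le_trans (norm_coord _ i)
  (le_trans (lipG vb (grid_pos_box _ rho0 _)) (ler_wpM2l (ltW L0) d1)).
rewrite [X in `|X|]mxE [X in _ + X]mxE => E1.
have E2 := HA a i.
have E3 : `|\sum_j (w 0 j - m%:R * s * (a j)%:R) * A i j| <= n%:R * (m%:R * s).
  apply: sum_norm_le => j; rewrite normrM -[leRHS]mulr1.
  by apply: ler_pM => //; have := a_itv j; rewrite ler_norml; lra.
have sE : \sum_j (w 0 j - m%:R * s * (a j)%:R) * A i j =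
    \sum_j w 0 j * A i j - m%:R * s * \sum_j (a j)%:R * A i j.
  rewrite mulr_sumr -sumrB; apply: eq_bigr => j _; ring.
have -> : \sum_j w 0 j * (L * A i j) = L * \sum_j w 0 j * A i j.
  by rewrite mulr_sumr; apply: eq_bigr => j _; ring.
have Ls0 : 0 < L * s by rewrite mulr_gt0.
move: E2; rewrite -(ler_pM2l Ls0) -{1}(gtr0_norm Ls0) -normrM.
have -> : L * s * (f i (b + lattice_vec e a *+ m) - f i b - m%:R * \sum_j (a j)%:R * A i j) =
   G (grid_pos z rho (b + lattice_vec e a *+ m)) 0 i - G (grid_pos z rho b) 0 i
   - L * (m%:R * s * \sum_j (a j)%:R * A i j).
  by rewrite /f; field; rewrite ?gt_eqF.
move: E3; rewrite sE -(ler_pM2l L0 `|_ - _ * \sum_j (a j)%:R * _|).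
rewrite -{1}(gtr0_norm L0) -normrM mulrBr.
move: E1; set g1 := G (X p + v) 0 i; set g2 := G _ 0 i; set g3 := G _ 0 i.
rewrite -[(3 * n).+1%:R]natr1 !natrM.
set S1 := L * \sum_j _; set S2 := L * (_ * _).
rewrite !ler_norml; lra.
Qed.
End Step.

(** A count: slopes on a grid of spacing [2 * C * s] have distinct corners, and there are at least
    [(beta / s) ^ n] of them, against [(8 * rho / s) ^ n] elements of the group. The bad elements
    are a fraction of order [1 / K] of the latter, so for large [K] some slope has a good corner. *)
Lemma approx_affine (tau eps : R) : 0 < tau -> 0 < eps -> eps <= rho ->
  exists p, `|p| <= delta /\ exists h, 0 < h <= eps /\
    exists B : 'M[R]_n, (forall i j, `|B i j| <= L) /\
      forall v, `|v| <= h -> `|G (X p + v) - G (X p) - v *m B| <= tau * h.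
Proof.
move=> tau0 eps0 epsr.
(* [h] is [M.+1 / 4] lattice steps long, so a large [M] makes the fixed part [3 * n + 1] of the
   error small against [h]; [sigma] then does the same for the other part. *)
have [M' HM'] := exists_nat_gt (16 * L * (3 * n).+1%:R / tau).
pose M := M'.+3; have M3 : (3 <= M)%N by [].
have HM : 16 * L * (3 * n).+1%:R <= tau * M.+1%:R.
  rewrite [leRHS]mulrC -ler_pdivrMr // (le_trans (ltW HM')) // ler_nat /M; lia.
pose sigma := tau / (16 * L * n.+1%:R).
have L16 : 0 < 16 * L * n.+1%:R by rewrite !mulr_gt0.
have sigma0 : 0 < sigma by rewrite divr_gt0.
have Hsigma : 16 * L * (n * M.+1)%:R * sigma <= tau * M.+1%:R.
  rewrite /sigma mulrA ler_pdivrMr //.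
  rewrite (_ : tau * _ * _ = tau * M.+1%:R * (16 * L) * n.+1%:R); last by ring.
  rewrite (_ : _ * tau = tau * M.+1%:R * (16 * L) * n%:R); last by rewrite natrM; ring.
  by rewrite ler_pM2l ?mulr_gt0 // ler_nat.
(* [beta] is a lower bound, independent of the mesh, for [s * D], where [D] is the number of slopes
   per axis; [K] is then so large that the bad set cannot contain [D ^ n] corners. *)
clearbody sigma; pose beta := delta / (4 * C); have beta0 : 0 < beta by rewrite divr_gt0 ?mulr_gt0.
have r8 : 0 < 8 * rho by rewrite mulr_gt0.
have [K HK] := exists_nat_gt
  ((n * n * (M.+1 ^ n * M.+1))%:R * (8 * rho) ^+ n / (sigma ^+ 2 * beta ^+ n)).
have K0 : (0 < K)%N.
  rewrite -(ltr_nat R); apply: le_lt_trans HK.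
  by rewrite divr_ge0 // mulr_ge0 ?exprn_ge0 ?(ltW r8) ?(ltW sigma0) ?(ltW beta0).
have {}HK : (n * n * (M.+1 ^ n * M.+1))%:R * (8 * rho) ^+ n < beta ^+ n * (sigma ^+ 2 * K%:R).
  have sb0 : 0 < sigma ^+ 2 * beta ^+ n by apply: mulr_gt0; apply: exprn_gt0.
  by move: HK; rewrite ltr_pdivrMr // mulrCA [X in beta ^+ n * X]mulrC; congr (_ < _); ring.
(* The mesh is fixed last, so fine that [h <= eps] whichever scale [k < K] is selected. *)
pose smin := Num.min (eps / (M.+1 ^ K)%:R) (Num.min rho beta).
have MK0 : 0 < (M.+1 ^ K)%:R :> R by rewrite ltr0n expn_gt0.
have smin0 : 0 < smin by rewrite !lt_min rho0 beta0 divr_gt0.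
have [q Hq] := exists_nat_gt (4 * rho / smin).
pose s := 4 * rho / q.+1%:R.
have s0 : 0 < s by rewrite divr_gt0 ?mulr_gt0.
have sq : s * q.+1%:R = 4 * rho by rewrite divfK // pnatr_eq0.
have ss : s <= smin.
  rewrite /s ler_pdivrMr // [leRHS]mulrC -ler_pdivrMr // (le_trans (ltW Hq)) // ler_nat //.
have [sK sr sb] : [/\ (M.+1 ^ K)%:R * s <= eps, s <= rho & s <= beta].
  by move: ss; rewrite !le_min ler_pdivlMr // mulrC => /and3P[].
pose f (i : 'I_n) x := G (grid_pos z rho (q := q) x) 0 i / (L * s).
pose e (j : 'I_n) : 'rV['I_(q.*2.+2)]_n := delta_mx 0 j.
have [k kK [bad Hbad good]] := quantitative_differentiation (e := e) (M := M.+1)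
  isT K0 sigma0 (grid_lip (q := q)).
pose h := (M.+1 ^ k.+1)%:R * s / 4.
have h0 : 0 < h by rewrite divr_gt0 ?mulr_gt0 // ltr0n expn_gt0.
have heps : h <= eps.
  have : (M.+1 ^ k.+1)%:R * s <= (M.+1 ^ K)%:R * s.
    by rewrite ler_wpM2r ?(ltW s0) // ler_nat leq_pexp2l.
  have : 0 < (M.+1 ^ k.+1)%:R * s by rewrite mulr_gt0 // ltr0n expn_gt0.
  by rewrite /h; move: sK; lra.
have hrho : h <= rho by apply: le_trans heps epsr.
(* Twice the resolution of [corner_inj], so that distinct indices give distinct corners. *)
pose g := 2 * C * s; have g0 : 0 < g by rewrite !mulr_gt0.
pose D := Num.trunc (delta / g).
have Dg : g * D%:R <= delta.
  by have /andP[] := trunc_div_itv g0 (ltW delta0).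
have Dbeta : beta <= s * D%:R.
  have /andP[_] := trunc_div_itv g0 (ltW delta0); rewrite -/D /g => D1.
  have bE : delta = 4 * C * beta by rewrite /beta; field; rewrite gt_eqF.
  move: D1; rewrite bE -(ler_pM2l C0) => D1.
  have : C * s <= C * beta by rewrite ler_pM2l.
  by lra.
pose pt (a : {ffun 'I_n -> 'I_D}) : 'rV[R]_n := \row_i (g * (a i)%:R).
have ptd a : `|pt a| <= delta.
  apply: norm_le => [|i]; first exact: ltW.
  rewrite mxE ger0_norm; last by apply: mulr_ge0 => //; apply: ltW.
  apply: le_trans Dg.
  by rewrite ler_pM2l // ler_nat ltnW // ltn_ord.
have cinj : injective (fun a => corner q M k (pt a)).
  move=> a b /(corner_inj hrho M3 sr (ptd a) (ptd b)) ab; apply/ffunP => i; apply: val_inj => /=.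
  have := coord_itvB i ab; rewrite !mxE -mulrBr -/s.
  have -> : C * s = g / 2 by rewrite /g; field.
  case: (ltngtP (a i) (b i)) => //; rewrite -(ler_nat R) -natr1 => lt_ab ?.
    have : g * 1 <= g * ((b i)%:R - (a i)%:R) by rewrite ler_pM2l //; lra.
    by move=> *; exfalso; have := g0; lra.
  have : g * 1 <= g * ((a i)%:R - (b i)%:R) by rewrite ler_pM2l //; lra.
  by move=> *; exfalso; have := g0; lra.
have [a abad] : exists a, corner q M k (pt a) \notin bad.
  apply: contrapT => /forallNP abad.
  have : (D ^ n <= #|bad|)%N.
    rewrite -[D in (D ^ _)%N]card_ord -[n in (_ ^ n)%N](card_ord n) -card_ffun.
    rewrite -(card_imset _ cinj); apply: subset_leq_card.
    by apply/fintype.subsetP => _ /imsetP[a _ ->]; apply: contrapT => /negP; apply: abad.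
  rewrite -(ler_nat R) natrX => Dbad.
  move: HK; apply/negP; rewrite -leNgt.
  apply: (@le_trans _ _ (s ^+ n * (#|bad|%:R * (sigma ^+ 2 * K%:R)))).
    rewrite [leRHS]mulrA; apply: ler_wpM2r; first by rewrite mulr_ge0 ?exprn_ge0 // ltW.
    apply: le_trans (_ : (s * D%:R) ^+ n <= _).
      by rewrite lerXn2r ?nnegrE // ?(ltW beta0) // (le_trans (ltW beta0)).
    by rewrite exprMn ler_wpM2l // exprn_ge0 // ltW.
  apply: le_trans (ler_wpM2l (exprn_ge0 _ (ltW s0)) Hbad) _.
  rewrite card_mx card_ord mul1n [in leLHS]natrM natrX mulrCA -exprMn.
  suff -> : s * q.*2.+2%:R = 8 * rho by [].
  by rewrite -doubleS -mul2n natrM mulrCA sq; ring.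
exists (pt a); split; first exact: ptd.
exists h; split; first by rewrite h0.
have [A A1 HA] := good _ abad.
exists (\matrix_(j, i) (L * A i j)); split.
  by move=> i j; rewrite mxE normrM gtr0_norm // -[leRHS]mulr1 ler_pM2l.
have main := corner_affine hrho M3 (ptd a) A1 HA.
move=> v vh; apply: norm_le => [|i]; first by rewrite mulr_ge0 // ltW.
have m1 := main v i vh.
have m2 := main 0 i; rewrite normr0 in m2; have {}m2 := m2 (ltW h0).
rewrite addr0 in m2; move: m1 m2.
set gb := grid_pos z rho _; set err := _ * (_ + _) => m1 m2.
(* The estimates at [v] and at 0 are subtracted to eliminate the grid point, hence twice the
   error. *)
have err2 : 2 * err <= tau * h.
  pose ms := s * (M.+1 ^ k)%:R.
  have ms0 : 0 <= ms / 4 by rewrite divr_ge0 // mulr_ge0 // ltW.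
  have -> : 2 * err = (8 * L * ((n * M.+1)%:R * sigma + (3 * n).+1%:R)) * (ms / 4).
    by rewrite /err -/s /ms; field.
  have -> : tau * h = tau * M.+1%:R * (ms / 4).
    by rewrite /h /ms expnS natrM; field.
  by apply: ler_wpM2r => //; move: HM Hsigma; lra.
have vB : (v *m \matrix_(j, i) (L * A i j)) 0 i = \sum_j v 0 j * (L * A i j).
  by rewrite mxE; apply: eq_bigr => j _; rewrite !mxE.
have sB : \sum_j (X (pt a) + v - gb) 0 j * (L * A i j) =
   \sum_j (X (pt a) - gb) 0 j * (L * A i j) + \sum_j v 0 j * (L * A i j).
  by rewrite -big_split /=; apply: eq_bigr => j _; rewrite addrAC [X in X * _]mxE mulrDl.
rewrite mxE [X in _ + X]mxE vB mxE [X in _ + X - _]mxE.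
by move: m1 m2; rewrite sB !ler_norml; lra.
Qed.
End ApproxAffine.

(** * Doubling of variables *)

Section Dotp.
Variables (R : realType) (n : nat).
Implicit Types (u v w d : 'rV[R]_n) (c : R).

Lemma dotpC u v : dotp u v = dotp v u.
Proof. by apply: eq_bigr => i _; rewrite mulrC. Qed.

Lemma dotpDl u v w : dotp (u + v) w = dotp u w + dotp v w.
Proof. by rewrite -big_split; apply: eq_bigr => i _; rewrite mxE mulrDl. Qed.

Lemma dotpDr u v w : dotp w (u + v) = dotp w u + dotp w v.
Proof. by rewrite dotpC dotpDl !(dotpC w). Qed.

Lemma dotpZl c u v : dotp (c *: u) v = c * dotp u v.
Proof. by rewrite mulr_sumr; apply: eq_bigr => i _; rewrite mxE mulrA. Qed.

Lemma dotpZr c u v : dotp u (c *: v) = c * dotp u v.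
Proof. by rewrite dotpC dotpZl dotpC. Qed.

Lemma dotpNl u v : dotp (- u) v = - dotp u v.
Proof. by rewrite -scaleN1r dotpZl mulN1r. Qed.

Lemma dotpNr u v : dotp u (- v) = - dotp u v.
Proof. by rewrite dotpC dotpNl dotpC. Qed.

Lemma dotp0l u : dotp 0 u = 0.
Proof. by rewrite -(scale0r 0) dotpZl mul0r. Qed.

Lemma dotp0r u : dotp u 0 = 0.
Proof. by rewrite dotpC dotp0l. Qed.

Lemma dotp_delta u i : dotp u (delta_mx 0 i) = u 0 i.
Proof.
rewrite /dotp (bigD1 i) //= mxE !eqxx mulr1 big1 ?addr0 // => j /negPf ji.
by rewrite mxE eqxx ji mulr0.
Qed.

Lemma dotp_norm_le u v : `|dotp u v| <= n%:R * (`|u| * `|v|).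
Proof. by apply: sum_norm_le => i; rewrite normrM ler_pM ?norm_coord. Qed.

Lemma dotp_le_of u v c c' : `|u| <= c -> `|v| <= c' -> dotp u v <= n%:R * (c * c').
Proof.
move=> uc vd; apply: le_trans (ler_norm _) _; apply: le_trans (dotp_norm_le _ _) _.
by rewrite ler_wpM2l // ler_pM.
Qed.

Lemma dotpvv_ge0 v : 0 <= dotp v v.
Proof. by apply: sumr_ge0 => i _; rewrite -expr2 sqr_ge0. Qed.

Lemma coord_sqr_le v i : v 0 i ^+ 2 <= dotp v v.
Proof.
rewrite /dotp (bigD1 i) //= -expr2 lerDl sumr_ge0 // => j _.
by rewrite -expr2 sqr_ge0.
Qed.

Lemma norm_sqr_le v : `|v| ^+ 2 <= dotp v v.
Proof.
have v0 := dotpvv_ge0 v.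
rewrite -(sqr_sqrtr v0) lerXn2r ?nnegrE ?sqrtr_ge0 //.
apply: norm_le => [|i]; first exact: sqrtr_ge0.
by rewrite -sqrtr_sqr ler_wsqrtr // coord_sqr_le.
Qed.

Lemma dotpvv_le v : dotp v v <= n%:R * `|v| ^+ 2.
Proof. by apply: le_trans (ler_norm _) _; apply: dotp_norm_le. Qed.

Lemma norm_le_enorm v : `|v| <= enorm v.
Proof.
rewrite -(@ler_pXn2r _ 2%N) ?nnegrE ?sqrtr_ge0 //.
by rewrite sqr_sqrtr ?dotpvv_ge0 // norm_sqr_le.
Qed.

(** With [v = t *: d] the left side is of order [t] and the right side of order [t ^ 2], impossible
    for small [t] unless [d] vanishes. *)
Lemma first_order_zero d rho c : 0 < rho ->
  (forall v, `|v| <= rho -> dotp d v <= c * `|v| ^+ 2) -> d = 0.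
Proof.
move=> rho0 H; have [//|dn] := eqVneq d 0.
have d0 : 0 < `|d| by rewrite normr_gt0.
pose t := Num.min (rho / `|d|) ((2 * (`|c| + 1))^-1).
have c1 : 0 < 2 * (`|c| + 1) by rewrite mulr_gt0 // ltr_wpDl.
have t0 : 0 < t by rewrite lt_min divr_gt0 //= invr_gt0.
have t1 : t * `|d| <= rho by rewrite -ler_pdivlMr // ge_min lexx.
have t2 : t * (2 * (`|c| + 1)) <= 1.
  by rewrite -ler_pdivlMr // mul1r ge_min lexx orbT.
have := H (t *: d); rewrite normrZ gtr0_norm // => /(_ t1).
rewrite dotpZr exprMn => Ht.
have := norm_sqr_le d; have : 0 < `|d| ^+ 2 by rewrite exprn_gt0.
set D := `|d| ^+ 2 in Ht * => D0 Dd.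
have h1 : t * D <= c * (t ^+ 2 * D) by apply: le_trans Ht; rewrite ler_pM2l.
have h2 : c * (t ^+ 2 * D) <= `|c| * (t ^+ 2 * D).
  by rewrite ler_wpM2r ?ler_norm // mulr_ge0 ?sqr_ge0 // ltW.
have h3 : t * D * (t * (2 * (`|c| + 1))) <= t * D * 1 by rewrite ler_pM2l ?mulr_gt0.
have h4 : 0 < t * D by rewrite mulr_gt0.
have h5 : 0 < t * D * t by rewrite mulr_gt0.
by exfalso; move: h1 h2 h3 h4 h5; rewrite expr2; set C := `|c|; nra.
Qed.

Lemma cvg_dotp_coord (T : Type) (F : set_system T) {FF : Filter F}
    (f g : T -> 'rV[R]_n) (a b : 'rV[R]_n) :
  (forall i, f x 0 i @[x --> F] --> a 0 i) ->
  (forall i, g x 0 i @[x --> F] --> b 0 i) ->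
  dotp (f x) (g x) @[x --> F] --> dotp a b.
Proof.
move=> fa gb; rewrite /dotp.
elim: (index_enum _) => [|i r IH].
  by rewrite big_nil; under eq_fun do rewrite big_nil; apply: cvg_cst.
rewrite big_cons; under eq_fun do rewrite big_cons.
by apply: cvgD; [exact: cvgM|exact: IH].
Qed.

Lemma cvg_coord (T : Type) (F : set_system T) {FF : Filter F}
    (f : T -> 'rV[R]_n) (a : 'rV[R]_n) i :
  f x @[x --> F] --> a -> f x 0 i @[x --> F] --> a 0 i.
Proof. by move=> fa; exact: (cvg_comp _ _ fa (@coord_continuous R 1 n 0 i a)). Qed.

Lemma cvg_dotp (T : Type) (F : set_system T) {FF : Filter F}
    (f g : T -> 'rV[R]_n) (a b : 'rV[R]_n) :
  f x @[x --> F] --> a -> g x @[x --> F] --> b ->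
  dotp (f x) (g x) @[x --> F] --> dotp a b.
Proof. by move=> fa gb; apply: cvg_dotp_coord => i; apply: cvg_coord. Qed.

Lemma cvg_quadratic (T : Type) (F : set_system T) {FF : Filter F}
    (f : T -> 'rV[R]_n) (a : 'rV[R]_n) (S : 'M[R]_n) :
  f x @[x --> F] --> a -> dotp (f x *m S) (f x) @[x --> F] --> dotp (a *m S) a.
Proof.
move=> fa; apply: cvg_dotp_coord => i; last exact: cvg_coord.
have E v : (v *m S) 0 i = dotp v (\row_j S j i).
  by rewrite mxE; apply: eq_bigr => j _; rewrite mxE.
by rewrite E; under eq_fun do rewrite E; apply: cvg_dotp => //; apply: cvg_cst.
Qed.

Lemma compact_box (z : 'rV[R]_n) c : compact [set x | `|x - z| <= c].
Proof.
have [c0|c0] := ltP c 0.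
  rewrite (_ : [set x | _] = set0); first exact: compact0.
  by apply/seteqP; split => // x /= /le_lt_trans/(_ c0); rewrite normr_lt0.
rewrite (_ : [set x | _] =
  [set v : 'rV[R]_n | forall i, `[z 0 i - c, z 0 i + c]%classic (v ord0 i)]).
  apply: (@rV_compact _ _ (fun i => `[z 0 i - c, z 0 i + c]%classic)) => i.
  exact: segment_compact.
apply/seteqP; split => x /= H.
  by move=> i; have := coord_itvB i H; rewrite in_itv /=; lra.
apply: norm_le => // i; have := H i; rewrite in_itv /= !mxE ler_norml.
by rewrite -[ord0]/(0 : 'I_1); lra.
Qed.

Lemma compact_max (T : topologicalType) (A : set T) (f : T -> R) :
  A !=set0 -> compact A -> (forall x, A x -> {for x, continuous f}) ->
  exists2 x, A x & forall y, A y -> f y <= f x.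
Proof.
move=> A0 cA cf.
have [|x xA xm] := @compact_EVT_max _ _ f A A0 cA.
  by apply: continuous_in_subspaceT => x /set_mem; apply: cf.
by exists x; [apply: set_mem|move=> y yA; apply: xm; apply: mem_set].
Qed.

End Dotp.

(** A mean value inequality without differentiation: over [m] equal steps the first-order terms add
    up to at most [e] and the quadratic errors to at most [|c| / m], which is below any given
    [d]. *)
Lemma increment_le (R : realType) (k kd : R -> R) (c e : R) : 0 <= e ->
  (forall t t', 0 <= t <= 1 -> 0 <= t' <= 1 ->
     `|k t' - k t - kd t * (t' - t)| <= c * (t' - t) ^+ 2) ->
  (forall t, 0 <= t <= 1 -> `|kd t| <= e) -> `|k 1 - k 0| <= e.
Proof.
move=> e0 Hk Hkd; apply/ler_addgt0Pr => d d0.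
have [m Hm] := exists_nat_gt (`|c| / d).
have m0 : 0 < m%:R :> R by apply: le_lt_trans Hm; rewrite divr_ge0 // ltW.
have mn : (0 < m)%N by rewrite -(ltr_nat R).
have step i : (i < m)%N -> `|k (i.+1%:R / m%:R) - k (i%:R / m%:R)| <= (e + d) / m%:R.
  move=> im.
  have t01 : 0 <= (i%:R / m%:R : R) <= 1.
    by rewrite divr_ge0 //= ler_pdivrMr // mul1r ler_nat ltnW.
  have t01' : 0 <= (i.+1%:R / m%:R : R) <= 1.
    by rewrite divr_ge0 //= ler_pdivrMr // mul1r ler_nat.
  have := Hk _ _ t01 t01'; have := Hkd _ t01.
  have -> : (i.+1%:R / m%:R - i%:R / m%:R : R) = 1 / m%:R.
    by rewrite -mulrBl -natr1 addrAC subrr add0r.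
  set K := k _ - _; set D := kd _ => HD HK.
  have h1 : `|D * (1 / m%:R)| <= e / m%:R.
    by rewrite div1r normrM (ger0_norm (_ : 0 <= m%:R^-1)) ?invr_ge0 // ler_wpM2r ?invr_ge0.
  have h2 : c * (1 / m%:R) ^+ 2 <= d / m%:R.
    apply: (@le_trans _ _ (`|c| * (1 / m%:R) ^+ 2)); first by rewrite ler_wpM2r ?sqr_ge0 ?ler_norm.
    rewrite div1r expr2 mulrA ler_pM2r ?invr_gt0 // ler_pdivrMr // mulrC -ler_pdivrMr //.
    exact: ltW.
  by move: HK h1; rewrite mulrDl !ler_norml; lra.
have -> : k 1 - k 0 = \sum_(0 <= i < m) (k (i.+1%:R / m%:R) - k (i%:R / m%:R)).
  by rewrite telescope_sumr // divff ?gt_eqF // mul0r.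
rewrite big_mkord; apply: le_trans (ler_norm_sum _ _ _) _.
apply: (@le_trans _ _ (\sum_(i < m) (e + d) / m%:R)).
  by apply: ler_sum => i _; apply: step.
by rewrite sumr_const card_ord -[_ *+ m]mulr_natr divfK // gt_eqF.
Qed.

(** * Maximum points of the doubled function *)

Section Contact.
Variables (R : realType) (n : nat) (z : 'rV[R]_n) (rho L c : R).
Variables (u psi : 'rV[R]_n -> R) (G : 'rV[R]_n -> 'rV[R]_n).
Hypotheses (rho0 : 0 < rho) (L0 : 0 < L) (c0 : 0 < c).
Let box (x : 'rV[R]_n) := `|x - z| <= 4 * rho.
Hypothesis expand : forall x y, box x -> box y ->
  `|psi x - psi y - dotp (G y) (x - y)| <= L * `|x - y| ^+ 2.
Hypothesis lip : forall x y, box x -> box y -> `|psi x - psi y| <= L * `|x - y|.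
Hypothesis lipG : forall x y, box x -> box y -> `|G x - G y| <= L * `|x - y|.
Hypothesis strict_max : forall y, box y -> u y - psi y <= u z - psi z - c * `|y - z| ^+ 2.
Hypothesis cont_u : forall x, box x -> {for x, continuous u}.
Hypothesis cont_psi : forall x, box x -> {for x, continuous psi}.

Definition doubled (k : R) (p x y : 'rV[R]_n) : R :=
  u y - k * dotp (x - y) (x - y) - psi x - dotp p (x - z).

Definition contact (k : R) (p x y : 'rV[R]_n) : Prop :=
  [/\ box x, box y &
      forall x' y', box x' -> box y' -> doubled k p x' y' <= doubled k p x y].

Let boxz : box z. Proof. by rewrite /box subrr normr0 mulr_ge0 // ltW. Qed.

Let boxD x v : `|x - z| <= 2 * rho -> `|v| <= 2 * rho -> box (x + v).
Proof.
move=> xz vr; rewrite /box addrAC (le_trans (ler_normD _ _)) //; lra.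
Qed.

Lemma contact_exists k p : exists x y, contact k p x y.
Proof.
have [|||[x y]/= [xb yb] xymax] := @compact_max R _
   ([set x | box x] `*` [set y | box y]) (fun xy => doubled k p xy.1 xy.2).
- by exists (z, z).
- by apply: compact_setX; apply: compact_box.
- move=> [x y] [/= xb yb]; rewrite /doubled.
  have c1 : xy.1 @[xy --> (x, y)] --> x by apply: cvg_fst.
  have c2 : xy.2 @[xy --> (x, y)] --> y by apply: cvg_snd.
  apply: cvgB; last by apply: cvg_dotp; [exact: cvg_cst|apply: cvgB => //; exact: cvg_cst].
  apply: cvgB; last by apply: (cvg_comp _ _ c1); apply: cont_psi.
  apply: cvgB; first by apply: (cvg_comp _ _ c2); apply: cont_u.
  by apply: cvgM; [exact: cvg_cst|apply: cvg_dotp; apply: cvgB].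
by exists x, y; split => // x' y' xb' yb'; apply: (xymax (x', y')).
Qed.

(** The first bound compares the maximum with the value at [(y, y)], the second with the value at
    [(z, z)], where strictness of the maximum pulls [y] towards [z]. *)
Lemma contact_close k p x y delta : 0 < k -> `|p| <= delta -> contact k p x y ->
  `|x - y| <= (L + n%:R * delta) / k /\
  c * `|y - z| ^+ 2 <= n%:R * (delta * (4 * rho)) + L * `|x - y|.
Proof.
move=> k0 pd [xb yb H]; split.
  have := H y y yb yb; rewrite /doubled subrr dotp0l mulr0 subr0.
  have -> : y - z = (y - x) + (x - z) by rewrite addrA subrK.
  rewrite dotpDr => h1.
  have h2 := dotp_le_of pd (lexx `|y - x|).
  have := lip yb xb; rewrite ler_norml => /andP[_ h3].
  have h4 := norm_sqr_le (x - y).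
  rewrite distrC in h2 h3.
  have h5 : k * `|x - y| ^+ 2 <= (L + n%:R * delta) * `|x - y|.
    have : k * `|x - y| ^+ 2 <= k * dotp (x - y) (x - y) by rewrite ler_pM2l.
    by lra.
  have [->|xy] := eqVneq (x - y) 0.
    by rewrite normr0 divr_ge0 ?addr_ge0 ?mulr_ge0 ?(ltW k0) ?(ltW L0) // (le_trans _ pd).
  rewrite ler_pdivlMr // -(@ler_pM2r _ `|x - y|) ?normr_gt0 //.
  by move: h5; rewrite expr2; lra.
have := H z z boxz boxz; rewrite /doubled subrr dotp0l mulr0 subr0 dotp0r subr0.
have h1 : 0 <= k * dotp (x - y) (x - y) by rewrite mulr_ge0 ?dotpvv_ge0 // ltW.
have := dotp_le_of (_ : `|- p| <= delta) xb; rewrite normrN dotpNl => /(_ pd) h2.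
have := lip xb yb; rewrite ler_norml => h3.
have := strict_max yb; lra.
Qed.

(** This is stationarity in [x]: the box leaves room to move [x] by [v], and [first_order_zero]
    discards the quadratic remainders. *)
Lemma contact_grad k p x y : contact k p x y -> `|x - z| <= rho ->
  p = - (2 * k) *: (x - y) - G x.
Proof.
move=> [xb yb H] xz; apply/eqP; rewrite -subr_eq0 -oppr_eq0; apply/eqP.
apply: (@first_order_zero _ _ _ rho (`|k| * n%:R + L)) => // v vr.
have r0 := rho0; have xvb : box (x + v) by apply: boxD; lra.
have := H _ _ xvb yb; rewrite /doubled.
have -> : x + v - y = (x - y) + v by rewrite addrAC.
have -> : x + v - z = (x - z) + v by rewrite addrAC.
set a := x - y; set b := x - z; clearbody a b.
rewrite dotpNl !dotpDl !dotpNl dotpDl dotpZl dotpNl !dotpDr (dotpC v a) => h1.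
have := expand xvb xb; rewrite (addrAC x v) subrr add0r ler_norml => /andP[_ h2].
have h3 : k * dotp v v <= `|k| * n%:R * `|v| ^+ 2.
  apply: (@le_trans _ _ (`|k| * dotp v v)); first by rewrite ler_wpM2r ?ler_norm ?dotpvv_ge0.
  by rewrite -mulrA ler_wpM2l // dotpvv_le.
by move: h1 h2 h3; lra.
Qed.

(** Maximising over [y] leaves a semiconvex function of [x], touched from above at [x] by an affine
    function of slope [p]; at such points the slope is Lipschitz. Concretely, maximality at [(x, y)]
    is tested with [(x', y')] and maximality at [(x', y')] with [(x' + e, y)]: the values of [u]
    cancel in the sum, and [contact_grad] removes the terms of first order in [v]. *)
Lemma contact_inv k p p' x y x' y' t : 0 < k -> contact k p x y -> contact k p' x' y' ->
  `|x - z| <= rho -> `|x' - z| <= rho -> 0 < t -> t <= rho -> `|x - x'| <= t ->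
  `|p - p'| <= 4 * (k * n%:R + L) * t.
Proof.
move=> k0 pc pc' xz xz' t0 tr xx'.
have pE := contact_grad pc xz; move: pc pc' => [xb yb H] [xb' yb' H'].
have k4 : 0 <= 4 * (k * n%:R + L) * t.
  by rewrite mulr_ge0 ?(ltW t0) // mulr_ge0 // addr_ge0 ?(ltW L0) // mulr_ge0 // ltW.
have key e : `|e| <= t -> dotp (p - p') e <= (k * n%:R + L) * (2 * t) ^+ 2.
  move=> et; have r0 := rho0.
  have xe : box (x' + e) by apply: boxD; lra.
  pose v := x' + e - x.
  have vt : `|v| <= 2 * t.
    rewrite /v addrAC (le_trans (ler_normD _ _)) //.
    by rewrite distrC; lra.
  have := H' (x' + e) y xe yb; have := H x' y' xb' yb'; rewrite /doubled.
  have -> : x' + e - y = (x - y) + v by rewrite /v [RHS]addrC addrA subrK.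
  have -> : x' + e - z = (x' - z) + e by rewrite addrAC.
  have -> : x' - z = (x - z) + (v - e).
    by rewrite /v [x' + e]addrC -[e + x' - x]addrA [e + _]addrC addrK [RHS]addrC addrA subrK.
  have := expand xe xb; rewrite -/v ler_norml => /andP[_].
  have vsq : `|v| ^+ 2 <= (2 * t) ^+ 2.
    by rewrite lerXn2r ?nnegrE // mulr_ge0 // ltW.
  have : L * `|v| ^+ 2 <= L * (2 * t) ^+ 2 by rewrite ler_pM2l.
  have : k * dotp v v <= k * (n%:R * (2 * t) ^+ 2).
    rewrite ler_pM2l // (le_trans (dotpvv_le _)) //.
    by rewrite ler_wpM2l.
  have : dotp p v = - (2 * k) * dotp (x - y) v - dotp (G x) v.
    by rewrite {1}pE [LHS]dotpDl [X in X + _]dotpZl dotpNl.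
  set a := x - y; set b := x - z; set gx := G x; clearbody a b gx v.
  rewrite !dotpDl !dotpDr !dotpNr !dotpNl (dotpC v a).
  by lra.
apply: norm_le => // i.
have /key : `|t *: delta_mx 0 i : 'rV[R]_n| <= t.
  rewrite normrZ gtr0_norm // -[leRHS]mulr1 ler_pM2l //.
  apply: norm_le => // j; rewrite mxE eqxx /=.
  by case: eqP => _; rewrite ?normr1 ?normr0.
have /key : `|(- t) *: delta_mx 0 i : 'rV[R]_n| <= t.
  rewrite normrZ normrN gtr0_norm // -[leRHS]mulr1 ler_pM2l //.
  apply: norm_le => // j; rewrite mxE eqxx /=.
  by case: eqP => _; rewrite ?normr1 ?normr0.
rewrite !dotpZr !dotp_delta; set d := (p - p') 0 i => h1 h2.
suff : `|t * d| <= t * (4 * (k * n%:R + L) * t) by rewrite normrM gtr0_norm // ler_pM2l.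
by rewrite ler_norml; move: h1 h2; rewrite expr2; lra.
Qed.

(** Moving [x] and [y] by the same [v] leaves the penalty unchanged. *)
Lemma contact_above k p x y v : contact k p x y -> `|x - z| <= 2 * rho -> `|y - z| <= 2 * rho ->
  `|v| <= 2 * rho -> u (y + v) <= u y + (psi (x + v) - psi x) + dotp p v.
Proof.
move=> [xb yb H] xz yz vr.
have := H (x + v) (y + v) (boxD xz vr) (boxD yz vr); rewrite /doubled.
have -> : x + v - (y + v) = x - y by rewrite opprD addrACA subrr addr0.
have -> : x + v - z = (x - z) + v by rewrite addrAC.
by rewrite [dotp p (_ + v)]dotpDr; lra.
Qed.

(** The affine approximation of [G] is integrated along the segment from [x] to [x + v]: [kd] is the
    derivative of [k], and [increment_le] applies. *)
Lemma psi_quadratic x h tau (B : 'M[R]_n) : `|x - z| <= 2 * rho -> h <= 2 * rho ->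
  (forall v, `|v| <= h -> `|G (x + v) - G x - v *m B| <= tau * h) ->
  forall v, `|v| <= h ->
  `|psi (x + v) - psi x - dotp (G x) v - 2^-1 * dotp (v *m B) v| <= n%:R * (tau * h * h).
Proof.
move=> xz hr HB v vh; have h0 : 0 <= h by apply: le_trans vh.
have th0 : 0 <= tau * h.
  by have := HB 0; rewrite normr0 => /(_ h0); apply: le_trans.
pose k t := psi (x + t *: v) - t * dotp (G x) v - 2^-1 * t ^+ 2 * dotp (v *m B) v.
pose kd t := dotp (G (x + t *: v) - G x - (t *: v) *m B) v.
have tv t : 0 <= t <= 1 -> `|t *: v| <= h.
  move=> /andP[t0 t1]; rewrite normrZ ger0_norm //; apply: le_trans vh.
  by rewrite ler_piMl.
have := @increment_le _ k kd (L * `|v| ^+ 2 + `|dotp (v *m B) v|) (n%:R * (tau * h * h)).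
have -> : k 1 - k 0 = psi (x + v) - psi x - dotp (G x) v - 2^-1 * dotp (v *m B) v.
  by rewrite /k scale1r scale0r addr0 expr1n expr0n /=; ring.
apply.
- by rewrite mulr_ge0 // mulr_ge0.
- move=> t t' t01 t01'.
  have tb : box (x + t *: v) by apply: boxD => //; apply: le_trans hr; apply: tv.
  have tb' : box (x + t' *: v) by apply: boxD => //; apply: le_trans hr; apply: tv.
  have := expand tb' tb.
  have -> : x + t' *: v - (x + t *: v) = (t' - t) *: v.
    by rewrite opprD addrACA subrr add0r scalerBl.
  rewrite dotpZr normrZ exprMn.
  rewrite real_normK ?num_real // /k /kd -scalemxAl !dotpDl !dotpNl dotpZl.
  set q := dotp (v *m B) v; set g1 := dotp (G (x + _)) v; set g0 := dotp (G x) v.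
  have h1 := ler_norm q; have h2 := ler_norm (- q); rewrite normrN in h2.
  have h3 : 0 <= (t' - t) ^+ 2 by rewrite sqr_ge0.
  have h4 : (t' - t) ^+ 2 * q <= (t' - t) ^+ 2 * `|q| by rewrite ler_wpM2l.
  have h5 : (t' - t) ^+ 2 * - q <= (t' - t) ^+ 2 * `|q| by rewrite ler_wpM2l.
  have h6 : 0 <= (t' - t) ^+ 2 * `|q| by rewrite mulr_ge0.
  by move: h4 h5 h6; rewrite !ler_norml; lra.
- move=> t t01; apply: le_trans (dotp_norm_le _ _) _.
  by rewrite ler_wpM2l // ler_pM // HB // tv.
Qed.

End Contact.

(** * Symmetric forms and exact touching by perturbed quadratics *)

Section SymForm.
Variables (R : realType) (n : nat).
Implicit Types (u v : 'rV[R]_n) (S B : 'M[R]_n).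

Lemma dotp_mulmx u v B : dotp (u *m B) v = dotp u (v *m B^T).
Proof.
have E (a b : 'rV[R]_n) : dotp a b = (a *m b^T) 0 0.
  by rewrite mxE; apply: eq_bigr => i _; rewrite mxE.
by rewrite !E trmx_mul trmxK mulmxA.
Qed.

Lemma dotp_symC u v S : S^T = S -> dotp (u *m S) v = dotp (v *m S) u.
Proof. by move=> Ssym; rewrite dotp_mulmx Ssym dotpC. Qed.

Definition symm B : 'M[R]_n := 2^-1 *: (B + B^T).

Lemma symm_sym B : (symm B)^T = symm B.
Proof. by rewrite /symm linearZ linearD /= trmxK addrC. Qed.

Lemma dotp_symm v B : dotp (v *m symm B) v = dotp (v *m B) v.
Proof.
rewrite /symm -scalemxAr dotpZl mulmxDr dotpDl [in X in _ + X]dotp_mulmx trmxK.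
by rewrite (dotpC v); lra.
Qed.

Lemma symm_le B c i j : (forall i j, `|B i j| <= c) -> `|symm B i j| <= c.
Proof.
move=> H; rewrite !mxE; have := H i j; have := H j i.
by rewrite !ler_norml; lra.
Qed.

(** Adding [t / 2 * dotp v v] turns a bound with error [tau * h ^+ 2] into exact touching: since
    [t > 2 * tau], the added term beats the error where [|v| = h], so the maximum of the difference
    lies inside. *)
Lemma touch_above (w : 'rV[R]_n -> R) y h l S tau t :
  0 < h -> 2 * tau < t -> S^T = S ->
  (forall v, `|v| <= h -> {for y + v, continuous w}) ->
  (forall v, `|v| <= h -> w (y + v) <= w y + dotp l v + 2^-1 * dotp (v *m S) v + tau * h ^+ 2) ->
  exists2 v0, `|v0| < h & exists2 r, 0 < r & forall v, `|v| < r ->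
    w (y + v0 + v) <= w (y + v0) + dotp (l + v0 *m S + t *: v0) v
      + 2^-1 * dotp (v *m (S + t%:M)) v.
Proof.
move=> h0 tau_t Ssym cw Hw.
pose q v := w (y + v) - dotp l v - 2^-1 * dotp (v *m S) v - t / 2 * dotp v v.
have [|||v0 /= v0h v0max] := @compact_max R _ [set v : 'rV[R]_n | `|v - 0| <= h] q.
- by exists 0; rewrite /= subr0 normr0 ltW.
- exact: compact_box.
- move=> v /=; rewrite subr0 => vh.
  have cid : v' @[v' --> v] --> v by exact: cvg_id.
  have c1 : w (y + v') @[v' --> v] --> w (y + v).
    have cy : y + v' @[v' --> v] --> y + v by exact: (cvgD (cvg_cst y) cid).
    exact: (cvg_comp _ _ cy (cw v vh)).
  have c2 : dotp l v' @[v' --> v] --> dotp l v by exact: (cvg_dotp (cvg_cst l) cid).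
  have c3 : dotp (v' *m S) v' @[v' --> v] --> dotp (v *m S) v by exact: (cvg_quadratic cid).
  have c4 : dotp v' v' @[v' --> v] --> dotp v v by exact: (cvg_dotp cid cid).
  exact: (cvgB (cvgB (cvgB c1 c2) (cvgMl_tmp c3)) (cvgMl_tmp c4)).
rewrite subr0 in v0h.
have tau0 : 0 <= tau.
  have := Hw 0; rewrite normr0 addr0 mul0mx dotp0l dotp0r mulr0 !addr0 lerDl.
  by move=> /(_ (ltW h0)); rewrite pmulr_lge0 // exprn_gt0.
have v0lt : `|v0| < h.
  rewrite ltNge; apply/negP => hv0.
  have h2 : h ^+ 2 <= dotp v0 v0.
    by apply: le_trans (norm_sqr_le _); rewrite lerXn2r ?nnegrE // ltW.
  have := v0max 0; rewrite subr0 normr0 => /(_ (ltW h0)).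
  rewrite /q addr0 mul0mx !dotp0l dotp0r !mulr0 !subr0.
  have := Hw _ v0h.
  have : 0 < (t / 2 - tau) * h ^+ 2 by rewrite mulr_gt0 ?exprn_gt0 //; lra.
  have : t / 2 * h ^+ 2 <= t / 2 * dotp v0 v0 by rewrite ler_wpM2l //; lra.
  by lra.
exists v0 => //; exists (h - `|v0|); first by rewrite subr_gt0.
move=> v vr.
have := v0max (v0 + v); rewrite subr0 (le_trans (ler_normD _ _)); last by rewrite -lerBrDl ltW.
move=> /(_ isT); rewrite /q addrA.
rewrite !mulmxDl !mulmxDr !dotpDl !dotpDr mul_mx_scalar !dotpZl.
rewrite (dotp_symC v v0 Ssym) (dotpC v v0).
by lra.
Qed.
End SymForm.

(** * Comparison of a subsolution with a strict supersolution *)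

Section Comparison.
Variables (R : realType) (n : nat) (z : 'rV[R]_n) (rho L c : R).
Variables (u psi : 'rV[R]_n -> R) (G : 'rV[R]_n -> 'rV[R]_n).
Hypotheses (rho0 : 0 < rho) (L0 : 0 < L) (c0 : 0 < c).
Let box (x : 'rV[R]_n) := `|x - z| <= 4 * rho.
Hypothesis expand : forall x y, box x -> box y ->
  `|psi x - psi y - dotp (G y) (x - y)| <= L * `|x - y| ^+ 2.
Hypothesis lip : forall x y, box x -> box y -> `|psi x - psi y| <= L * `|x - y|.
Hypothesis lipG : forall x y, box x -> box y -> `|G x - G y| <= L * `|x - y|.
Hypothesis strict_max : forall y, box y -> u y - psi y <= u z - psi z - c * `|y - z| ^+ 2.
Hypothesis cont_u : forall x, box x -> {for x, continuous u}.
Hypothesis cont_psi : forall x, box x -> {for x, continuous psi}.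

Lemma quadratic_contact eps tau : 0 < eps -> 0 < tau ->
  exists p x y h S,
    [/\ `|p| <= eps, `|x - z| <= rho, `|y - z| <= rho, `|x - y| <= eps & 0 < h <= eps] /\
    [/\ h <= rho, S^T = S, forall i j, `|S i j| <= L,
      forall v, `|v| <= h ->
        `|psi (x + v) - psi x - dotp (G x) v - 2^-1 * dotp (v *m S) v| <= tau * h ^+ 2 &
      forall v, `|v| <= h -> u (y + v) <= u y + (psi (x + v) - psi x) + dotp p v].
Proof.
move=> eps0 tau0.
have n1 : 0 < n.+1%:R :> R by [].
have nn1 : n%:R <= n.+1%:R :> R by rewrite ler_nat.
(* [delta] and [d] make the two terms in the second bound of [contact_close] at most
   [c * rho ^+ 2 / 8] each, which puts [y] within [rho / 2] of [z]; [k] is then fixed so that [x]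
   and [y] are within [d]. *)
pose delta := Num.min eps (c * rho / (32 * n.+1%:R)).
have delta0 : 0 < delta by rewrite lt_min eps0 divr_gt0 ?mulr_gt0.
have delta_c : n%:R * (delta * (4 * rho)) <= c * rho ^+ 2 / 8.
  have h1 : delta * (32 * n.+1%:R) <= c * rho.
    by rewrite -ler_pdivlMr ?mulr_gt0 // ge_min lexx orbT.
  have h2 : n%:R * (delta * (4 * rho)) <= n.+1%:R * (delta * (4 * rho)).
    by rewrite ler_wpM2r // mulr_ge0 ?mulr_ge0 // ltW.
  have h3 : delta * (32 * n.+1%:R) * rho <= c * rho * rho by rewrite ler_pM2r.
  by move: h2 h3; rewrite expr2; lra.
pose d := Num.min eps (Num.min (rho / 2) (c * rho ^+ 2 / (8 * L))).
have d0 : 0 < d by rewrite !lt_min eps0 !divr_gt0 ?mulr_gt0 ?exprn_gt0.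
have [d_eps d_rho d_c] : [/\ d <= eps, d <= rho / 2 & L * d <= c * rho ^+ 2 / 8].
  have : d <= d by [].
  rewrite {2}/d !le_min => /and3P[-> -> dL]; split=> //.
  rewrite ler_pdivlMr ?mulr_gt0 // in dL.
  by lra.
have Ln0 : 0 < L + n%:R * delta by rewrite ltr_wpDr // mulr_ge0 // ltW.
pose k := (L + n%:R * delta) / d; have k0 : 0 < k by rewrite divr_gt0.
have kd : (L + n%:R * delta) / k = d by rewrite /k invf_div mulrC divfK // gt_eqF.
pose X p := sval (cid (contact_exists rho0 cont_u cont_psi k p)).
pose Y p := sval (cid (svalP (cid (contact_exists rho0 cont_u cont_psi k p)))).
have XY p : contact z rho u psi k p (X p) (Y p).
  exact: (svalP (cid (svalP (cid (contact_exists rho0 cont_u cont_psi k p))))).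
have close p : `|p| <= delta -> [/\ `|X p - Y p| <= d, `|Y p - z| <= rho / 2 & `|X p - z| <= rho].
  move=> pd; have [] := contact_close rho0 L0 lip strict_max k0 pd (XY p).
  rewrite kd => xy yz.
  have yz2 : `|Y p - z| <= rho / 2.
    rewrite -(@ler_pXn2r _ 2%N) ?nnegrE ?divr_ge0 ?(ltW rho0) // -(ler_pM2l c0).
    have : L * `|X p - Y p| <= L * d by rewrite ler_pM2l.
    by rewrite exprMn; move: yz delta_c d_c; rewrite !expr2; lra.
  split => //; rewrite -(subrKA (Y p)) (le_trans (ler_normD _ _)) //.
  by lra.
pose C := 4 * (k * n%:R + L).
have C0 : 0 < C by rewrite mulr_gt0 // ltr_wpDl // mulr_ge0 // ltW.
have box2 x : `|x - z| <= 2 * rho -> box x by move=> /le_trans; apply; have := rho0; lra.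
have lipG2 x y : `|x - z| <= 2 * rho -> `|y - z| <= 2 * rho ->
  `|G x - G y| <= L * `|x - y| by move=> /box2 ? /box2 ?; apply: lipG.
have invX p p' t : `|p| <= delta -> `|p'| <= delta ->
    0 < t -> t <= rho -> `|X p - X p'| <= t -> `|p - p'| <= C * t.
  move=> pd pd' t0 tr; have [_ _ xz] := close p pd; have [_ _ xz'] := close p' pd'.
  exact: (contact_inv rho0 L0 expand k0 (XY p) (XY p') xz xz').
have boxX p : `|p| <= delta -> `|X p - z| <= rho by move=> /close[].
have tn0 : 0 < tau / n.+1%:R by rewrite divr_gt0.
have er0 : 0 < Num.min eps rho by rewrite lt_min eps0.
have er : Num.min eps rho <= rho by rewrite ge_min lexx orbT.
have [p [pd [h [/andP[h0 her] [B [BL HB]]]]]] :=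
  approx_affine rho0 L0 C0 delta0 lipG2 boxX invX tn0 er0 er.
have [xy yz xz] := close p pd.
have hr : h <= rho by apply: le_trans er.
have heps : h <= eps by apply: le_trans her _; rewrite ge_min lexx.
exists p, (X p), (Y p), h, (symm B); split; split => //.
- by apply: le_trans pd _; rewrite ge_min lexx.
- by have := rho0; lra.
- exact: le_trans d_eps.
- by rewrite h0.
- exact: symm_sym.
- by move=> i j; apply: symm_le.
- move=> v vh; rewrite dotp_symm.
  have xz2 : `|X p - z| <= 2 * rho by have := rho0; lra.
  have hr2 : h <= 2 * rho by have := rho0; lra.
  apply: le_trans (psi_quadratic expand xz2 hr2 HB vh) _.
  have -> : n%:R * (tau / n.+1%:R * h * h) = n%:R * (tau / n.+1%:R) * h ^+ 2 by ring.
  by rewrite ler_wpM2r ?sqr_ge0 // mulrA ler_pdivrMr // mulrC ler_pM2l.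
- move=> v vh; apply: (contact_above (XY p)); have := rho0; lra.
Qed.

Variables (F : 'rV[R]_n -> 'M[R]_n -> R) (eta m1 Lt : R).
Hypotheses (eta0 : 0 < eta) (m10 : 0 < m1) (Lt0 : 0 < Lt).
Hypothesis subjet : forall y l X, `|y - z| <= 2 * rho -> l != 0 -> X^T = X ->
  (exists2 r, 0 < r & forall v, `|v| < r ->
     u (y + v) <= u y + dotp l v + 2^-1 * dotp (v *m X) v) -> 0 <= F y X.
Hypothesis superjet : forall x l X, `|x - z| <= 2 * rho -> X^T = X ->
  (exists2 r, 0 < r & forall v, `|v| < r ->
     psi x + dotp l v + 2^-1 * dotp (v *m X) v <= psi (x + v)) -> F x X <= - eta.
Hypothesis contF : forall b e, 0 < e -> exists2 d, 0 < d &
  forall x y X, `|x - z| <= 2 * rho -> `|y - z| <= 2 * rho -> `|x - y| <= d ->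
    X^T = X -> (forall i j, `|X i j| <= b) -> F x X <= F y X + e.
Hypothesis shiftF : forall x X t, `|x - z| <= 2 * rho -> X^T = X -> 0 <= t ->
  F x (X + t%:M) <= F x X + Lt * t.
Hypothesis gradG : forall x, `|x - z| <= rho -> m1 <= `|G x|.

Theorem no_strict_contact : False.
Proof.
(* The Hessians [S + t] for [u] and [S - t] for [psi] differ by [2 * t], which costs [eta / 4] with
   this [t]; moving the base point costs another [eta / 4], and together they give
   [0 <= - eta + eta / 2]. *)
pose t := eta / (8 * Lt).
have t0 : 0 < t by rewrite divr_gt0 ?mulr_gt0.
have Lt_t : Lt * t = eta / 8 by rewrite /t; field; rewrite gt_eqF.
have [d d0 Hd] := contF (L + t) (divr_gt0 eta0 (ltr0n R 4)).
have n1 : 0 < n.+1%:R :> R by [].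
(* The three bounds serve the continuity of [F] in the point and keep [p] and [v0 *m S + t *: v0]
   below [m1 / 4] each. *)
pose eps := Num.min (Num.min (d / 4) (m1 / 4)) (m1 / (4 * (n%:R * L + t))).
have nLt : 0 < n%:R * L + t by rewrite ltr_wpDl // mulr_ge0 // ltW.
have eps0 : 0 < eps by rewrite !lt_min !divr_gt0 ?mulr_gt0.
have [e_d e_m e_n] : [/\ eps <= d / 4, eps <= m1 / 4 & eps * (n%:R * L + t) <= m1 / 4].
  have : eps <= eps by [].
  rewrite {2}/eps !le_min => /andP[/andP[-> ->] eL]; split=> //.
  rewrite ler_pdivlMr ?mulr_gt0 // in eL; lra.
have t40 : 0 < t / 4 by rewrite divr_gt0.
have [p [x [y [h [S]]]]] := quadratic_contact eps0 t40.
move=> [[pe xz yz xy /andP[h0 he]] [hr Ssym SL Hpsi Hu]].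
have St : (S + t%:M)^T = S + t%:M by rewrite linearD /= Ssym tr_scalar_mx.
have St' : (S - t%:M)^T = S - t%:M by rewrite linearB /= Ssym tr_scalar_mx.
have near2 a v : `|a - z| <= rho -> `|v| <= h -> `|a + v - z| <= 2 * rho.
  by move=> az vh; rewrite addrAC (le_trans (ler_normD _ _)) //; lra.
have near4 a v : `|a - z| <= rho -> `|v| <= h -> box (a + v).
  by move=> az vh; rewrite /box (le_trans (near2 a v az vh)) //; have := rho0; lra.
have tt : 2 * (t / 4) < t by lra.
have [v0 v0h [r r0 Hr]] := @touch_above _ _ u y h (G x + p) S (t / 4) t h0 tt Ssym
  (fun v vh => cont_u (near4 y v yz vh))
  (fun v vh => ltac:(have := Hu v vh; have := Hpsi v vh; rewrite dotpDl ler_norml; lra)).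
have Fu : 0 <= F (y + v0) (S + t%:M).
  apply: (subjet (near2 y v0 yz (ltW v0h)) _ St); last by exists r => //; exact: Hr.
  (* A subsolution jet with zero slope would give no information on [F]; the lower bound on [G]
     excludes it. *)
  apply/eqP => l0.
  have : `|G x| <= `|p| + `|v0 *m S + t *: v0|.
    have -> : G x = - (p + (v0 *m S + t *: v0)).
      by apply/eqP; rewrite -subr_eq0 opprK; apply/eqP; rewrite -l0 !addrA.
    by rewrite normrN ler_normD.
  have : `|v0 *m S + t *: v0| <= eps * (n%:R * L + t).
    have v0e : `|v0| <= eps by apply: le_trans he; apply: ltW.
    rewrite (le_trans (ler_normD _ _)) // normrZ gtr0_norm // mulrDr lerD //.
      apply: norm_le => [|j]; first by rewrite mulr_ge0 ?mulr_ge0 // ltW.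
      rewrite mxE mulrCA; apply: sum_norm_le => i.
      by rewrite normrM ler_pM // (le_trans (norm_coord _ _)).
    by rewrite mulrC ler_pM2r.
  have := gradG xz; have := m10; move: pe e_m e_n; lra.
have ctN v : `|v| <= h -> {for x + v, continuous (fun a => - psi a)}.
  by move=> vh; exact: (cvgN (cont_psi (near4 x v xz vh))).
have NSsym : (- S)^T = - S by rewrite linearN /= Ssym.
(* Touching [psi] from below is touching its opposite from above, with [- S] in place of [S]. *)
have [v1 v1h [r' r'0 Hr']] := @touch_above _ _ (fun a => - psi a) x h
  (- G x) (- S) (t / 4) t h0 tt NSsym ctN
  (fun v vh => ltac:(have := Hpsi v vh; rewrite mulmxN !dotpNl ler_norml; lra)).
have Fpsi : F (x + v1) (S - t%:M) <= - eta.
  apply: (superjet (l := - (- G x + v1 *m - S + t *: v1)) (near2 x v1 xz (ltW v1h)) St').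
  exists r' => // v /Hr'.
  have -> : v *m (- S + t%:M) = - (v *m (S - t%:M)) by rewrite -mulmxN opprB addrC.
  by rewrite !dotpNl; lra.
have Sb i j : `|(S + t%:M) i j| <= L + t.
  rewrite mxE (le_trans (ler_normD _ _)) // lerD //.
  by rewrite mxE; case: eqP => _; rewrite ?mulr1n ?mulr0n ?normr0 ?gtr0_norm // ltW.
have dist : `|y + v0 - (x + v1)| <= d.
  rewrite opprD addrACA (le_trans (ler_normD _ _)) //.
  have : `|v0 - v1| <= `|v0| + `|v1| by apply: ler_normB.
  by move: xy; rewrite (distrC x y); lra.
have C1 := Hd _ _ _ (near2 y v0 yz (ltW v0h)) (near2 x v1 xz (ltW v1h)) dist St Sb.
have C2 := shiftF (near2 x v1 xz (ltW v1h)) St' (ltW (mulr_gt0 (ltr0n R 2) t0)).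
have E : S - t%:M + (2 * t)%:M = S + t%:M.
  by rewrite mulr_natl mulr2n raddfD /= addrA subrK.
rewrite E in C2; move: C1 C2 Fu Fpsi; rewrite mulrCA Lt_t.
have := eta0; lra.
Qed.

End Comparison.

(** * Viscosity solutions and elliptic operators *)

Section Jets.
Variables (R : realType) (n : nat).
Implicit Types (x y v l : 'rV[R]_n) (X : 'M[R]_n).

Lemma derive_taylor (f : 'rV[R]_n -> R) x v (d e : R) :
  (forall h, f (h *: v + x) = f x + h * d + h ^+ 2 * e) ->
  derivable f x v /\ 'D_v f x = d.
Proof.
move=> H.
have E : h^-1 *: ((f \o shift x) (h *: v) - f x) @[h --> 0^'] --> d.
  apply: (@cvg_trans _ ((d + h * e) @[h --> 0^'])).
    apply: near_eq_cvg; near=> h.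
    have h0 : h != 0 by near: h; apply: nbhs_dnbhs_neq.
    by rewrite /= H /GRing.scale /=; field.
  have h0 : h @[h --> (0 : R)^'] --> (0 : R) by exact: nbhs_dnbhs.
  have := cvgD (cvg_cst d) (cvgMr_tmp (b := e) h0).
  by rewrite mul0r addr0; apply.
by split; [apply/cvg_ex; exists d|apply: cvg_lim].
Unshelve. all: by end_near.
Qed.

(** The test function for a second-order jet: for symmetric [X] it is of class C^2 everywhere, with
    gradient [l] and Hessian [X] at [y]. *)
Definition qtest (y l : 'rV[R]_n) X x : R :=
  dotp l (x - y) + 2^-1 * dotp ((x - y) *m X) (x - y).

Lemma qtest_taylor y l X x v (h : R) : X^T = X ->
  qtest y l X (h *: v + x) = qtest y l X x + h * dotp (l + (x - y) *m X) v
    + h ^+ 2 * (2^-1 * dotp (v *m X) v).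
Proof.
move=> Xs; rewrite /qtest -addrA; set w := x - y; clearbody w.
rewrite !mulmxDl !dotpDl !dotpDr -!scalemxAl !dotpZl !dotpZr (dotp_symC v w Xs).
by field.
Qed.

Lemma partial_qtest y l X i : X^T = X ->
  (forall x, derivable (qtest y l X) x (delta_mx 0 i)) /\
  partial i (qtest y l X) = fun x => (l + (x - y) *m X) 0 i.
Proof.
move=> Xs; split=> [x|].
  by have [] := derive_taylor (fun h => qtest_taylor y l x (delta_mx 0 i) h Xs).
apply/funext => x; rewrite /partial.
have [_ ->] := derive_taylor (fun h => qtest_taylor y l x (delta_mx 0 i) h Xs).
by rewrite dotp_delta.
Qed.

Lemma partial_affine y l X i j :
  (forall x, derivable (fun x => (l + (x - y) *m X) 0 i : R) x (delta_mx 0 j)) /\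
  partial j (fun x => (l + (x - y) *m X) 0 i) = fun=> X j i.
Proof.
have H x h : (l + (h *: delta_mx 0 j + x - y) *m X) 0 i =
   (l + (x - y) *m X) 0 i + h * X j i + h ^+ 2 * 0.
  have -> : (h *: delta_mx 0 j + x - y) *m X = h *: row j X + (x - y) *m X.
    by rewrite -addrA mulmxDl -scalemxAl rowE.
  by rewrite !mxE; ring.
split=> [x|]; first by have [] := @derive_taylor (fun x => (l + (x - y) *m X) 0 i) _ _ _ _ (H x).
apply/funext => x; rewrite /partial.
by have [_ ->] := @derive_taylor (fun x => (l + (x - y) *m X) 0 i) _ _ _ _ (H x).
Qed.

Lemma cvg_sub y x : x' - y @[x' --> x] --> x - y.
Proof. exact: (cvgB cvg_id (cvg_cst y)). Qed.

Lemma cont_qtest y l X : continuous (qtest y l X).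
Proof.
move=> x; have c0 : x' - y @[x' --> x] --> x - y by exact: cvg_sub.
have c1 : dotp l (x' - y) @[x' --> x] --> dotp l (x - y) by exact: (cvg_dotp (cvg_cst l) c0).
have c2 : dotp ((x' - y) *m X) (x' - y) @[x' --> x] --> dotp ((x - y) *m X) (x - y).
  exact: (cvg_quadratic c0).
exact: (cvgD c1 (cvgMl_tmp c2)).
Qed.

Lemma cont_affine y l X i : continuous (fun x => (l + (x - y) *m X) 0 i : R).
Proof.
move=> x; have E x' : (l + (x' - y) *m X) 0 i = l 0 i + dotp (x' - y) (\row_j X j i).
  by rewrite mxE; congr (_ + _); rewrite mxE; apply: eq_bigr => j _; rewrite !mxE.
rewrite /continuous_at E; under eq_fun do rewrite E.
have c1 : dotp (x' - y) (\row_j X j i) @[x' --> x] --> dotp (x - y) (\row_j X j i).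
  have c0 : x' - y @[x' --> x] --> x - y by exact: cvg_sub.
  exact: (cvg_dotp c0 (cvg_cst _)).
exact: (cvgD (cvg_cst _) c1).
Qed.

Lemma C2_qtest A y l X : X^T = X -> C2 A (qtest y l X).
Proof.
move=> Xs; split=> [|i].
  split=> [|i]; first by apply: continuous_subspaceT; apply: cont_qtest.
  have [d ->] := partial_qtest y l i Xs.
  by split=> //; apply: continuous_subspaceT; apply: cont_affine.
have [_ ->] := partial_qtest y l i Xs.
split=> [|j]; first by apply: continuous_subspaceT; apply: cont_affine.
have [d ->] := partial_affine y l X i j.
by split=> //; apply: continuous_subspaceT => x; apply: cst_continuous.
Qed.

Lemma grad_qtest y l X : X^T = X -> grad (qtest y l X) y = l.
Proof.
move=> Xs; apply/rowP => i; rewrite mxE.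
by have [_ ->] := partial_qtest y l i Xs; rewrite subrr mul0mx addr0.
Qed.

Lemma hess_qtest y l X x : X^T = X -> hess (qtest y l X) x = X.
Proof.
move=> Xs; apply/matrixP => i j; rewrite mxE.
have [_ ->] := partial_qtest y l i Xs; have [_ ->] := partial_affine y l X i j.
by rewrite -{1}Xs mxE.
Qed.

Lemma near_norm y (r : R) : 0 < r -> \forall x \near y, `|x - y| < r.
Proof.
by move=> r0; near=> x; rewrite distrC; near: x; apply: cvgr_dist_lt.
Unshelve. all: by end_near.
Qed.

Lemma subsol_jet (G : 'rV[R]_n -> 'rV[R]_n -> 'M[R]_n -> R) h w y l X r :
  visc_subsol G h w -> eball 0 1 y -> X^T = X -> 0 < r ->
  (forall v, `|v| < r -> w (y + v) <= w y + dotp l v + 2^-1 * dotp (v *m X) v) ->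
  h y <= G y l X.
Proof.
move=> [_ Hw] yB Xs r0 H; have := Hw _ (C2_qtest (eball 0 1) y l Xs) y yB.
rewrite grad_qtest // hess_qtest //; apply.
near=> x; rewrite /= /qtest subrr dotp0r mul0mx dotp0r mulr0 addr0 subr0.
have /H : `|x - y| < r by near: x; apply: near_norm.
by rewrite addrCA subrr addr0; lra.
Unshelve. all: by end_near.
Qed.

Lemma supersol_jet (G : 'rV[R]_n -> 'rV[R]_n -> 'M[R]_n -> R) h w y l X r :
  visc_supersol G h w -> eball 0 1 y -> X^T = X -> 0 < r ->
  (forall v, `|v| < r -> w y + dotp l v + 2^-1 * dotp (v *m X) v <= w (y + v)) ->
  G y l X <= h y.
Proof.
move=> [_ Hw] yB Xs r0 H; have := Hw _ (C2_qtest (eball 0 1) y l Xs) y yB.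
rewrite grad_qtest // hess_qtest //; apply.
near=> x; rewrite /= /qtest subrr dotp0r mul0mx dotp0r mulr0 addr0 subr0.
have /H : `|x - y| < r by near: x; apply: near_norm.
by rewrite addrCA subrr addr0; lra.
Unshelve. all: by end_near.
Qed.

End Jets.

(** * Ellipticity along the identity, operator norm, continuity of the coefficients *)

Section Pucci.
Variables (R : realType) (n : nat).
Hypothesis n0 : (0 < n)%N.
Implicit Types (t e lam Lam : R).

Lemma eigenvalue_scalar t e : eigenvalue (t%:M : 'M[R]_n) e <-> e = t.
Proof.
split=> [/eigenvalueP[v]|->].
  rewrite mul_mx_scalar => /eqP; rewrite -subr_eq0 -scalerBl scaler_eq0 => /orP[|/eqP->].
    by rewrite subr_eq0 => /eqP.
  by rewrite eqxx.
apply/eigenvalueP; exists (delta_mx 0 (Ordinal n0)); first by rewrite mul_mx_scalar.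
apply/eqP => /matrixP/(_ 0 (Ordinal n0)); rewrite !mxE !eqxx /= => /eqP.
by rewrite oner_eq0.
Qed.

Lemma char_poly_scalar t : char_poly (t%:M : 'M[R]_n) = ('X - t%:P) ^+ n.
Proof. by rewrite /char_poly /char_poly_mx map_scalar_mx -raddfB det_scalar. Qed.

(** The only eigenvalue is [t], and its multiplicity [n] is read off the characteristic
    polynomial. *)
Lemma sum_eigen_scalar t (P : R -> Prop) : P t ->
  \sum_(e \in [set e : R | eigenvalue (t%:M : 'M[R]_n) e /\ P e])
     e *+ mup e (char_poly (t%:M : 'M[R]_n)) = t *+ n.
Proof.
move=> Pt; have -> : [set e : R | eigenvalue (t%:M : 'M[R]_n) e /\ P e] = [set t].
  apply/seteqP; split=> [e /= [/eigenvalue_scalar]//|e /= ->].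
  by split=> //; apply/eigenvalue_scalar.
by rewrite fsbig_set1 char_poly_scalar mup_XsubCX eqxx.
Qed.

Lemma sum_eigen_scalar0 t (P : R -> Prop) : ~ P t ->
  \sum_(e \in [set e : R | eigenvalue (t%:M : 'M[R]_n) e /\ P e])
     e *+ mup e (char_poly (t%:M : 'M[R]_n)) = 0.
Proof.
move=> Pt; have -> : [set e : R | eigenvalue (t%:M : 'M[R]_n) e /\ P e] = set0.
  by apply/seteqP; split=> e //= [/eigenvalue_scalar ->].
by rewrite fsbig_set0.
Qed.

Lemma pucci_plus_scalar lam Lam t : 0 <= t ->
  pucci_plus lam Lam (t%:M : 'M[R]_n) = Lam * (n%:R * t).
Proof.
rewrite le_eqVlt => /predU1P[<-|t0]; rewrite /pucci_plus /sum_pos_eigen /sum_neg_eigen.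
  by rewrite !sum_eigen_scalar0 ?ltxx // !mulr0 addr0.
rewrite (sum_eigen_scalar t0) sum_eigen_scalar0 ?mulr0 ?addr0 ?mulr_natl //.
by apply/negP; rewrite -leNgt ltW.
Qed.

Lemma pucci_minus_scalar lam Lam t : 0 <= t ->
  pucci_minus lam Lam ((- t)%:M : 'M[R]_n) = - (Lam * (n%:R * t)).
Proof.
rewrite le_eqVlt => /predU1P[<-|t0]; rewrite /pucci_minus /sum_pos_eigen /sum_neg_eigen.
  by rewrite oppr0 !sum_eigen_scalar0 ?ltxx // !mulr0 addr0 oppr0.
rewrite sum_eigen_scalar0; last by apply/negP; rewrite -leNgt oppr_le0 ltW.
rewrite (@sum_eigen_scalar _ (fun e => e < 0)) ?oppr_lt0 //.
by rewrite mulr0 add0r mulNrn mulrN mulr_natl.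
Qed.

Lemma elliptic_shift lam Lam (F : 'rV[R]_n -> 'M[R]_n -> R) x X t :
  uniformly_elliptic lam Lam F -> eball 0 1 x -> X^T = X -> 0 <= t ->
  F x (X + t%:M) <= F x X + Lam * (n%:R * t).
Proof.
move=> uF xB Xs t0; rewrite -lerBlDl -(pucci_plus_scalar lam Lam t0).
have St : Sym (X + t%:M) by rewrite /Sym /= linearD /= Xs tr_scalar_mx.
by have /andP[_] := uF x xB _ _ St Xs; rewrite addrAC subrr add0r.
Qed.

Lemma elliptic_lower lam Lam (F : 'rV[R]_n -> 'M[R]_n -> R) x t :
  uniformly_elliptic lam Lam F -> eball 0 1 x -> F x 0 = 0 -> 0 <= t ->
  - (Lam * (n%:R * t)) <= F x (- t)%:M.
Proof.
move=> uF xB F0 t0; rewrite -(pucci_minus_scalar lam Lam t0).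
have S1 : Sym ((- t)%:M : 'M[R]_n) by rewrite /Sym /= tr_scalar_mx.
have S2 : Sym (0 : 'M[R]_n) by rewrite /Sym /= trmx0.
by have /andP[+ _] := uF x xB _ _ S1 S2; rewrite F0 !subr0.
Qed.

Lemma enorm_le (v : 'rV[R]_n) : enorm v <= n.+1%:R * `|v|.
Proof.
rewrite -(@ler_pXn2r _ 2%N) ?nnegrE ?sqrtr_ge0 ?mulr_ge0 //.
rewrite sqr_sqrtr ?dotpvv_ge0 //; apply: le_trans (dotpvv_le _) _.
rewrite exprMn ler_wpM2r ?sqr_ge0 // -natrX ler_nat.
by rewrite (leq_trans (leqnSn n)) // leq_pmulr.
Qed.

Lemma enormZ (c : R) (v : 'rV[R]_n) : enorm (c *: v) = `|c| * enorm v.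
Proof.
by rewrite /enorm dotpZl dotpZr mulrA -expr2 sqrtrM ?sqr_ge0 // sqrtr_sqr.
Qed.

Lemma enorm_delta (i : 'I_n) : enorm (delta_mx 0 i : 'rV[R]_n) = 1.
Proof. by rewrite /enorm dotp_delta mxE !eqxx sqrtr1. Qed.

Lemma opnorm_ub (X : 'M[R]_n) b v : (forall i j, `|X i j| <= b) -> enorm v = 1 ->
  enorm (v *m X) <= n.+1%:R * (n%:R * b).
Proof.
move=> Xb v1; apply: le_trans (enorm_le _) _; rewrite ler_pM2l //.
have b0 : 0 <= b by apply: le_trans (Xb (Ordinal n0) (Ordinal n0)).
apply: norm_le => [|j]; first by rewrite mulr_ge0.
rewrite mxE; apply: sum_norm_le => i; rewrite normrM -[b]mul1r ler_pM //.
by rewrite -v1 (le_trans (norm_coord _ _)) // norm_le_enorm.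
Qed.

Lemma opnorm_le (X : 'M[R]_n) b : (forall i j, `|X i j| <= b) ->
  opnorm X <= n.+1%:R * (n%:R * b).
Proof.
move=> Xb; apply: ge_sup.
  exists (enorm (delta_mx 0 (Ordinal n0) *m X)), (delta_mx 0 (Ordinal n0)) => //=.
  exact: enorm_delta.
by move=> _ [v /= v1 <-]; apply: opnorm_ub.
Qed.

(** A nonzero row of [X] is the image of a unit vector. The crude bound by [opnorm_ub] is there
    because a supremum dominates its members only when the set is bounded. *)
Lemma opnorm_gt0 (X : 'M[R]_n) : X != 0 -> 0 < opnorm X.
Proof.
move=> X0; have [i [j Xij]] : exists i j, X i j != 0.
  apply: contrapT => H; move/eqP: X0; apply; apply/matrixP => i j; rewrite mxE.
  by apply/eqP; apply: contrapT => Xij; apply: H; exists i, j; apply/negP.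
have Xb i' j' : `|X i' j'| <= `|X|.
  rewrite [leRHS]/Num.norm /= mx_normrE.
  by apply/bigmax_geP; right => /=; exists (i', j').
apply: (@lt_le_trans _ _ (enorm (delta_mx 0 i *m X))).
  rewrite (lt_le_trans _ (norm_le_enorm _)) // (lt_le_trans _ (norm_coord _ j)) //.
  by rewrite -rowE mxE normr_gt0.
apply: ub_le_sup; last by exists (delta_mx 0 i) => //=; apply: enorm_delta.
by exists (n.+1%:R * (n%:R * `|X|)) => _ [v /= v1 <-]; apply: opnorm_ub.
Qed.

Lemma coeff_modulus_le CF omega (F : 'rV[R]_n -> 'M[R]_n -> R) x y X b :
  0 < CF -> is_modulus omega -> coeff_modulus CF omega F ->
  (forall x, eball 0 1 x -> F x 0 = 0) ->
  eball 0 1 x -> eball 0 1 y -> x != y -> X^T = X -> (forall i j, `|X i j| <= b) ->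
  F x X <= F y X + CF * omega (enorm (x - y)) * (n.+1%:R * (n%:R * b)).
Proof.
move=> CF0 [om0 _ _] cF F0 xB yB xy Xs Xb.
have xy0 : 0 < enorm (x - y).
  by rewrite (lt_le_trans _ (norm_le_enorm _)) // normr_gt0 subr_eq0.
have b0 : 0 <= b by apply: le_trans (Xb (Ordinal n0) (Ordinal n0)).
(* [Theta] ranges over nonzero matrices; at 0 both values of [F] vanish. *)
have [->|X0] := eqVneq X 0.
  by rewrite !F0 // add0r !mulr_ge0 // ?(ltW CF0) // ltW // om0.
have : ((`|F x X - F y X| / opnorm X)%:E <= Theta F x y)%E.
  by apply: ereal_sup_ubound; exists X.
move=> /le_trans/(_ (cF x y xB yB xy)).
rewrite lee_fin ler_pdivrMr ?opnorm_gt0 // => H.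
have : CF * omega (enorm (x - y)) * opnorm X <=
   CF * omega (enorm (x - y)) * (n.+1%:R * (n%:R * b)).
  rewrite ler_wpM2l ?opnorm_le //.
  by apply: mulr_ge0; apply: ltW => //; apply: om0.
by move: H; rewrite ler_norml; lra.
Qed.

(** The modulus is relative to the norm of [X], so [d] is uniform only over matrices with bounded
    entries; [|b| + 1] keeps [K] positive. *)
Lemma coeff_continuous CF omega (F : 'rV[R]_n -> 'M[R]_n -> R) b e :
  0 < CF -> is_modulus omega -> coeff_modulus CF omega F ->
  (forall x, eball 0 1 x -> F x 0 = 0) -> 0 < e ->
  exists2 d, 0 < d & forall x y X, eball 0 1 x -> eball 0 1 y -> `|x - y| <= d ->
    X^T = X -> (forall i j, `|X i j| <= b) -> F x X <= F y X + e.
Proof.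
move=> CF0 om cF F0 e0; have [om0 om_mono om_cvg] := om.
pose K := CF * (n.+1%:R * (n%:R * (`|b| + 1))).
have K0 : 0 < K by rewrite !mulr_gt0 ?ltr0n // ltr_wpDl.
have eK : 0 < e / K by rewrite divr_gt0.
have [r [r0 omr]] : exists r, 0 < r /\ omega r < e / K.
  have N1 : \forall r \near 0^'+, omega r < e / K.
    by apply: (cvgr_lt 0) om_cvg _ _ => //.
  have N2 : \forall r \near (0 : R)^'+, 0 < r by apply: nbhs_right_gt.
  by have [r []] := filter_ex (filterI N2 N1); exists r.
exists (r / n.+1%:R); first by rewrite divr_gt0.
move=> x y X xB yB xy Xs Xb.
have [->|xny] := eqVneq x y; first by rewrite lerDl ltW.
apply: le_trans (coeff_modulus_le CF0 om cF F0 xB yB xny Xs Xb) _.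
rewrite lerD2l.
have xy0 : 0 < enorm (x - y).
  by rewrite (lt_le_trans _ (norm_le_enorm _)) // normr_gt0 subr_eq0.
have xyr : enorm (x - y) <= r.
  apply: le_trans (enorm_le _) _; rewrite mulrC -ler_pdivlMr //.
have b0 : 0 <= b by apply: le_trans (Xb (Ordinal n0) (Ordinal n0)).
apply: (@le_trans _ _ (omega r * K)); last by rewrite -ler_pdivlMr // ltW.
rewrite /K [CF * omega _]mulrC -mulrA; apply: ler_pM.
- by rewrite ltW // om0.
- by rewrite mulr_ge0 ?mulr_ge0 // ltW.
- exact: om_mono.
- rewrite ler_pM2l // ler_pM2l // ler_wpM2l //; apply: le_trans (ler_norm b) _; lra.
Qed.

End Pucci.

(** * Euclidean norm and balls *)

Section EuclideanGeometry.
Variables (R : realType) (n : nat).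
Implicit Types (u v x y z : 'rV[R]_n) (r : R).

Lemma enorm_ge0 u : 0 <= enorm u. Proof. exact: sqrtr_ge0. Qed.

Lemma enorm_sqr u : enorm u ^+ 2 = dotp u u.
Proof. by rewrite sqr_sqrtr ?dotpvv_ge0. Qed.

Lemma cauchy_schwarz u v : dotp u v <= enorm u * enorm v.
Proof.
have [->|u0] := eqVneq u 0; first by rewrite dotp0l mulr_ge0 ?enorm_ge0.
have [->|v0] := eqVneq v 0; first by rewrite dotp0r mulr_ge0 ?enorm_ge0.
have pos (w : 'rV[R]_n) : w != 0 -> 0 < enorm w.
  by move=> w0; rewrite (lt_le_trans _ (norm_le_enorm _)) ?normr_gt0.
have ab := mulr_gt0 (pos u u0) (pos v v0).
have := dotpvv_ge0 (enorm v *: u - enorm u *: v).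
rewrite !dotpDl !dotpDr !dotpNl !dotpNr !dotpZl !dotpZr -!enorm_sqr (dotpC v u).
set a := enorm u in ab *; set b := enorm v in ab *; set d := dotp u v => H.
rewrite -subr_ge0 -(pmulr_rge0 _ ab) //.
by move: H; rewrite !expr2; lra.
Qed.

Lemma enormD u v : enorm (u + v) <= enorm u + enorm v.
Proof.
rewrite -(@ler_pXn2r _ 2%N) ?nnegrE ?enorm_ge0 ?addr_ge0 ?enorm_ge0 //.
rewrite enorm_sqr dotpDl !dotpDr (dotpC v u) sqrrD !enorm_sqr.
by have := cauchy_schwarz u v; rewrite mulr2n; lra.
Qed.

Lemma enormN u : enorm (- u) = enorm u.
Proof. by rewrite /enorm dotpNl dotpNr opprK. Qed.

Lemma enormD_ge u v : enorm u - enorm v <= enorm (u + v).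
Proof. by rewrite lerBlDr -{1}(addrK v u) -(enormN v) enormD. Qed.

(** The contact argument lives in cubes of the sup norm; this fits them into the Euclidean balls of
    the problem. *)
Lemma eball_box x0 r x : eball x0 r x ->
  exists2 rho, 0 < rho & forall y, `|y - x| <= rho -> eball x0 r y.
Proof.
rewrite /eball /= => xr; pose rho := (r - enorm (x - x0)) / (2 * n.+1%:R).
have d0 : 0 < r - enorm (x - x0) by rewrite subr_gt0.
exists rho; first by rewrite divr_gt0 ?mulr_gt0.
move=> y yx; rewrite -(subrKA x) (le_lt_trans (enormD _ _)) //.
have : enorm (y - x) <= (r - enorm (x - x0)) / 2.
  apply: le_trans (enorm_le _) _.
  rewrite mulrC -ler_pdivlMr // (le_trans yx) // /rho invfM mulrA lexx //.
by lra.
Qed.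

Lemma open_eball x0 r : open (eball x0 r : set 'rV[R]_n).
Proof.
rewrite openE => x /eball_box[rho rho0 H].
near=> y; apply: H; apply: ltW; near: y; exact: near_norm.
Unshelve. all: by end_near.
Qed.

Lemma compact_eball_closed x0 r : compact [set x : 'rV[R]_n | enorm (x - x0) <= r].
Proof.
apply: subclosed_compact (@compact_box R n x0 r) _; last first.
  by move=> x /= xr; apply: le_trans (norm_le_enorm _) xr.
have [r0|r0] := ltP r 0.
  rewrite (_ : [set x | _] = set0); first exact: closed0.
  by apply/seteqP; split => // x /= /le_lt_trans/(_ r0); rewrite ltNge enorm_ge0.
rewrite (_ : [set x | _] = (fun x => dotp (x - x0) (x - x0)) @^-1` [set y | y <= r ^+ 2]).
  apply: closed_comp; last exact: closed_le.
  move=> x _; have c0 : x' - x0 @[x' --> x] --> x - x0 by exact: cvg_sub.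
  exact: (cvg_dotp c0 c0).
by apply/seteqP; split => x /=; rewrite -enorm_sqr ler_pXn2r ?nnegrE ?enorm_ge0.
Qed.

(** Points slightly nearer to [x0] on the radius through [x] lie in the open ball, and for small [t]
    in the given neighbourhood. *)
Lemma sphere_bdry x0 r x : 0 < r -> enorm (x - x0) = r -> bdry (eball x0 r) x.
Proof.
move=> r0 xr; split; last first.
  by move=> /interior_subset; rewrite /eball /= xr ltxx.
move=> U /nbhs_ballP[e /= e0 eU].
pose t := Num.min (2^-1) (e / (2 * r)).
have t0 : 0 < t.
  rewrite lt_min; apply/andP; split; first by rewrite invr_gt0.
  by apply: divr_gt0 => //; apply: mulr_gt0.
have t1 : t <= 2^-1 by rewrite ge_min lexx.
have te : t * (2 * r) <= e by rewrite -ler_pdivlMr ?mulr_gt0 // ge_min lexx orbT.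
exists (x0 + (1 - t) *: (x - x0)); split.
  rewrite /eball /= addrAC subrr add0r enormZ xr ger0_norm; last by lra.
  by rewrite gtr_pMl // ltrBlDr ltrDl.
apply: eU; rewrite mx_norm_ball /ball_ /=.
have -> : x - (x0 + (1 - t) *: (x - x0)) = t *: (x - x0).
  by rewrite scalerBl scale1r opprD opprB addrA addrC subrK.
rewrite normrZ gtr0_norm //.
have : t * `|x - x0| <= t * r by rewrite ler_pM2l // -xr norm_le_enorm.
by have := mulr_gt0 t0 r0; lra.
Qed.

End EuclideanGeometry.

(** * Bounds extracted from the C^{1,1} norm *)

Section C11Bounds.
Variables (R : realType) (n : nat).
Hypothesis n0 : (0 < n)%N.

Lemma eball0E (x : 'rV[R]_n) : eball 0 1 x = (enorm x < 1 : Prop).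
Proof. by rewrite /eball /= subr0. Qed.

(** The three suprema are nonnegative, so each is at most their sum [N]. *)
Lemma C11norm_bounds (phi : 'rV[R]_n -> R) (N : R) :
  C11norm (eball 0 1) phi = N%:E ->
  (forall x, eball 0 1 x -> enorm (grad phi x) <= N) /\
  (forall x y, eball 0 1 x -> eball 0 1 y ->
    `|phi x - phi y - dotp (grad phi y) (x - y)| <= N * enorm (x - y) ^+ 2).
Proof.
rewrite /C11norm; set S1 := ereal_sup _; set S2 := ereal_sup _; set S3 := ereal_sup _.
have B0 : eball 0 1 (0 : 'rV[R]_n) by rewrite eball0E /enorm dotp0l sqrtr0.
(* A second point of the ball: without a pair of distinct points the third supremum would be that of
   the empty set, [-oo]. *)
pose e : 'rV[R]_n := 2^-1 *: delta_mx 0 (Ordinal n0).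
have Be : eball 0 1 e.
  by rewrite eball0E /e enormZ enorm_delta mulr1 gtr0_norm ?invf_lt1 ?ltr1n.
have e_neq0 : 0 != e.
  rewrite eq_sym /e scaler_eq0 invr_eq0 pnatr_eq0 /=.
  by apply/eqP => /matrixP/(_ 0 (Ordinal n0)); rewrite !mxE !eqxx /= => /eqP; rewrite oner_eq0.
have S1_ge0 : (0 <= S1)%E.
  by apply: (@le_trans _ _ (`|phi 0|)%:E); [rewrite lee_fin|apply: ereal_sup_ubound; exists 0].
have S2_ub x : eball 0 1 x -> ((enorm (grad phi x))%:E <= S2)%E.
  by move=> xB; apply: ereal_sup_ubound; exists x.
have S2_ge0 : (0 <= S2)%E by apply: le_trans (S2_ub 0 B0); rewrite lee_fin enorm_ge0.
have S3_ub x y : eball 0 1 x -> eball 0 1 y -> x != y ->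
  ((`|phi x - (phi y + dotp (grad phi y) (x - y))| / enorm (x - y) ^+ 2)%:E <= S3)%E.
  by move=> xB yB xy; apply: ereal_sup_ubound; exists (x, y).
have S3_ge0 : (0 <= S3)%E.
  by apply: le_trans (S3_ub 0 e B0 Be e_neq0); rewrite lee_fin divr_ge0 ?sqr_ge0.
move=> SN.
have S2N : (S2 <= N%:E)%E.
  by rewrite -SN; apply: (@le_trans _ _ (S1 + S2)%E); [exact: leeDr|exact: leeDl].
have S3N : (S3 <= N%:E)%E by rewrite -SN; apply: leeDr; apply: adde_ge0.
split=> [x xB|x y xB yB]; first by rewrite -lee_fin (le_trans (S2_ub x xB)).
have [->|xy] := eqVneq x y.
  by rewrite !subrr dotp0r subr0 normr0 enorm_sqr dotp0r mulr0.
have := le_trans (S3_ub x y xB yB xy) S3N; rewrite lee_fin ler_pdivrMr ?opprD ?addrA //.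
rewrite exprn_gt0 // (lt_le_trans _ (norm_le_enorm _)) // normr_gt0 subr_eq0 //.
Qed.

End C11Bounds.

(** * Nondegeneracy of the obstacle and exclusion of quadratic contact *)

Section ObstacleEstimates.
Variables (R : realType) (n : nat) (lam Lam gamma Upsilon N : R).
Variables (F : 'rV[R]_n -> 'M[R]_n -> R) (phi : 'rV[R]_n -> R).
Hypotheses (n0 : (0 < n)%N) (Lam0 : 0 < Lam) (gamma0 : 0 < gamma).
Hypotheses (Upsilon0 : 0 < Upsilon) (N0 : 0 < N).
Hypothesis ellF : uniformly_elliptic lam Lam F.
Hypothesis F0 : forall x, eball 0 1 x -> F x 0 = 0.
Hypothesis grad_phi : forall x, eball 0 1 x -> enorm (grad phi x) <= N.
Hypothesis expand_phi : forall x y, eball 0 1 x -> eball 0 1 y ->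
  `|phi x - phi y - dotp (grad phi y) (x - y)| <= N * enorm (x - y) ^+ 2.
Hypothesis super_phi : visc_supersol (degenerate gamma F) (fun=> - Upsilon) phi.

(** The expansion of [phi] provides a paraboloid of Hessian [- 2 * N] touching it from below. There
    [F] is at least [- 2 * N * Lam * n], so only a large enough gradient factor can bring the
    product down to [- Upsilon]. *)
Lemma grad_lower_bound x : eball 0 1 x ->
  (Upsilon / (2 * N * Lam * n%:R)) `^ gamma^-1 <= enorm (grad phi x).
Proof.
move=> xB; set kappa := Upsilon / _.
have n1 : 0 < n%:R :> R by rewrite ltr0n.
have D0 : 0 < 2 * N * Lam * n%:R by rewrite !mulr_gt0.
have kappa0 : 0 < kappa by rewrite divr_gt0.
have [rho rho0 box] := eball_box xB.
have Xs : ((- (2 * N))%:M : 'M[R]_n)^T = (- (2 * N))%:M by rewrite tr_scalar_mx.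
have H : enorm (grad phi x) `^ gamma * F x (- (2 * N))%:M <= - Upsilon.
  apply: (supersol_jet super_phi xB Xs rho0) => v vr.
  have xvB : eball 0 1 (x + v) by apply: box; rewrite addrAC subrr add0r ltW.
  have := expand_phi xvB xB; rewrite (addrAC x v) subrr add0r.
  rewrite ler_norml enorm_sqr => /andP[+ _].
  by rewrite mul_mx_scalar dotpZl; lra.
have N20 : 0 <= 2 * N by rewrite mulr_ge0 // ltW.
have low := elliptic_lower n0 ellF xB (F0 xB) N20.
have p0 : 0 <= enorm (grad phi x) `^ gamma by apply: powR_ge0.
have : enorm (grad phi x) `^ gamma * - (Lam * (n%:R * (2 * N))) <= - Upsilon.
  by apply: le_trans H; rewrite ler_wpM2l.
rewrite mulrN lerN2 => H2.
have : kappa <= enorm (grad phi x) `^ gamma.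
  by rewrite /kappa ler_pdivrMr //; move: H2; lra.
rewrite leNgt => /negP; rewrite leNgt => H3; apply/negP => lt; apply: H3.
have -> : kappa = (kappa `^ gamma^-1) `^ gamma by rewrite -powRrM mulVf ?gt_eqF // powRr1 // ltW.
by apply: gt0_ltr_powR; rewrite ?nnegrE ?enorm_ge0 ?powR_ge0.
Qed.

(** The expansion of [phi] forces the slope of any jet from below to be [grad phi x], of norm at
    most [N]; the gradient factor can then be divided out. *)
Lemma obstacle_jet x l X : eball 0 1 x -> X^T = X ->
  (exists2 r, 0 < r & forall v, `|v| < r ->
     phi x + dotp l v + 2^-1 * dotp (v *m X) v <= phi (x + v)) ->
  F x X <= - (Upsilon / N `^ gamma).
Proof.
move=> xB Xs [r r0 H].
have HJ := supersol_jet super_phi xB Xs r0 H; rewrite /degenerate in HJ.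
have [rho rho0 box] := eball_box xB.
have lE : l = grad phi x.
  apply/eqP; rewrite -subr_eq0; apply/eqP.
  pose b := \sum_i \sum_j `|X i j|.
  apply: (@first_order_zero _ _ _ (Num.min rho (r / 2)) (n%:R * N + n%:R * (n%:R * b))).
    by rewrite lt_min rho0 divr_gt0.
  move=> v; rewrite le_min => /andP[vrho vr].
  have vr' : `|v| < r by lra.
  have h1 := H v vr'.
  have xvB : eball 0 1 (x + v) by apply: box; rewrite addrAC subrr add0r.
  have := expand_phi xvB xB; rewrite (addrAC x v) subrr add0r.
  rewrite ler_norml enorm_sqr => /andP[_ h2].
  have h3 : N * dotp v v <= N * (n%:R * `|v| ^+ 2) by rewrite ler_pM2l // dotpvv_le.
  have b0 : 0 <= b by apply: sumr_ge0 => i _; apply: sumr_ge0.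
  have Xb i j : `|X i j| <= b.
    rewrite /b (bigD1 i) //= (bigD1 j) //= -addrA lerDl addr_ge0 ?sumr_ge0 // => k _.
    by rewrite sumr_ge0.
  have h4 : `|dotp (v *m X) v| <= n%:R * (n%:R * b) * `|v| ^+ 2.
    apply: le_trans (dotp_norm_le _ _) _; rewrite -mulrA ler_wpM2l // expr2 mulrA ler_wpM2r //.
    apply: norm_le => [|j]; first by rewrite mulr_ge0 ?mulr_ge0.
    rewrite mxE -mulrA; apply: sum_norm_le => i.
    by rewrite normrM mulrC ler_pM ?norm_coord.
  have h5 : 0 <= n%:R * (n%:R * b) * `|v| ^+ 2 by rewrite !mulr_ge0 // sqr_ge0.
  by rewrite dotpDl dotpNl; move: h4; rewrite ler_norml; lra.
rewrite {}lE in HJ.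
set a := enorm _ `^ gamma in HJ.
have a0 : 0 <= a by apply: powR_ge0.
have aA : a <= N `^ gamma.
  by apply: ge0_ler_powR; rewrite ?nnegrE ?enorm_ge0 ?(ltW N0) ?(ltW gamma0) ?grad_phi.
have A0 : 0 < N `^ gamma by apply: powR_gt0.
(* The sign comes first: the gradient factor may be replaced by its upper bound only when [F x X] is
   nonpositive. *)
have Fneg : F x X <= 0.
  rewrite leNgt; apply/negP => Fp.
  have := mulr_ge0 a0 (ltW Fp); have := Upsilon0; lra.
rewrite -mulNr ler_pdivlMr // mulrC; apply: le_trans HJ.
by rewrite ler_wnM2r.
Qed.

(** The paraboloid at [z] makes the maximum strict, as [no_strict_contact] requires. Together the
    two paraboloids add [4 * c] to the Hessian, which costs at most half of [eta], and at most
    [8 * c] to the gradient, which is at most half of [m0]. *)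
Lemma no_quadratic_contact CF omega (u : 'rV[R]_n -> R) c y0 z rho :
  0 < CF -> is_modulus omega -> coeff_modulus CF omega F ->
  visc_subsol (degenerate gamma F) (fun=> 0) u ->
  (forall x, eball 0 1 x -> {for x, continuous u}) ->
  (forall x, eball 0 1 x -> {for x, continuous phi}) ->
  0 < c -> 16 * c <= (Upsilon / (2 * N * Lam * n%:R)) `^ gamma^-1 ->
  8 * (Lam * (n%:R * c)) <= Upsilon / N `^ gamma ->
  0 < rho -> (forall x, `|x - z| <= 12 * rho -> eball 0 1 x) -> eball 0 1 y0 ->
  (forall y, `|y - z| <= 4 * rho ->
     u y - phi y - c * dotp (y - y0) (y - y0) <= u z - phi z - c * dotp (z - y0) (z - y0)) ->
  False.
Proof.
move=> CF0 om cF sub_u cont_u cont_phi c0 c_m c_eta rho0 box12 y0B Hmax.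
set m0 := _ `^ gamma^-1 in c_m; set eta := Upsilon / _ in c_eta.
have n1 : 0 < n%:R :> R by rewrite ltr0n.
have m00 : 0 < m0 by apply: powR_gt0; rewrite divr_gt0 ?mulr_gt0.
have eta0 : 0 < eta by rewrite divr_gt0 // powR_gt0.
have boxle a x : a <= 12 -> `|x - z| <= a * rho -> eball 0 1 x.
  by move=> a12 xz; apply: box12; apply: le_trans xz _; rewrite ler_wpM2r // ltW.
have le4 : (4 : R) <= 12 by rewrite ler_nat.
have le2 : (2 : R) <= 12 by rewrite ler_nat.
have zB : eball 0 1 z by apply: box12; rewrite subrr normr0 mulr_ge0 // ltW.
have dB x y : eball 0 1 x -> eball 0 1 y -> enorm (x - y) <= 2.
  rewrite !eball0E => x1 y1; apply: le_trans (enormD _ _) _; rewrite enormN.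
  by have := ltW x1; have := ltW y1; lra.
pose psi x := phi x + c * dotp (x - y0) (x - y0) + c * dotp (x - z) (x - z).
pose G x := grad phi x + (2 * c) *: (x - y0) + (2 * c) *: (x - z).
have shift x v : psi (x + v) - psi x =
    phi (x + v) - phi x + 2 * c * dotp (x - y0) v + 2 * c * dotp (x - z) v + 2 * c * dotp v v.
  have dd (a : 'rV[R]_n) : dotp (a + v) (a + v) = dotp a a + 2 * dotp a v + dotp v v.
    by rewrite dotpDl !dotpDr (dotpC v a); ring.
  by rewrite /psi !(addrAC x v) !dd; ring.
have Gdot y v : dotp (G y) v =
    dotp (grad phi y) v + 2 * c * dotp (y - y0) v + 2 * c * dotp (y - z) v.
  rewrite /G; move: (y - y0) (y - z) => a b.
  by rewrite !dotpDl !dotpZl.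
pose K := (N + 2 * c) * n%:R; have K0 : 0 < K by rewrite mulr_gt0 // addr_gt0 // mulr_gt0.
have expand x y : eball 0 1 x -> eball 0 1 y ->
    `|psi x - psi y - dotp (G y) (x - y)| <= K * `|x - y| ^+ 2.
  move=> xB yB; have := expand_phi xB yB; have := shift y (x - y).
  rewrite addrCA subrr addr0 enorm_sqr Gdot.
  set v := x - y; set d1 := dotp (grad phi y) v.
  set d2 := dotp (y - y0) v; set d3 := dotp (y - z) v.
  have h1 : (N + 2 * c) * dotp v v <= K * `|v| ^+ 2.
    by rewrite /K -mulrA ler_pM2l ?dotpvv_le // addr_gt0 // mulr_gt0.
  have h2 : 0 <= c * dotp v v by rewrite mulr_ge0 ?dotpvv_ge0 // ltW.
  by rewrite !ler_norml; lra.
have Gle x : eball 0 1 x -> `|G x| <= N + 8 * c.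
  move=> xB; apply: le_trans (norm_le_enorm _) _.
  apply: le_trans (enormD _ _) _; apply: le_trans (lerD (enormD _ _) (lexx _)) _.
  rewrite !enormZ gtr0_norm ?mulr_gt0 //.
  have h1 := grad_phi xB.
  have h2 : c * enorm (x - y0) <= c * 2 by rewrite ler_pM2l // dB.
  have h3 : c * enorm (x - z) <= c * 2 by rewrite ler_pM2l // dB.
  by lra.
have lip x y : eball 0 1 x -> eball 0 1 y ->
    `|psi x - psi y| <= (2 * K + n%:R * (N + 8 * c)) * `|x - y|.
  move=> xB yB; have := expand x y xB yB.
  have xy2 : `|x - y| <= 2 by rewrite (le_trans (norm_le_enorm _)) // dB.
  have h1 : K * `|x - y| ^+ 2 <= K * (2 * `|x - y|) by rewrite ler_pM2l // expr2 ler_wpM2r.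
  have h2 : `|dotp (G y) (x - y)| <= n%:R * (N + 8 * c) * `|x - y|.
    apply: le_trans (dotp_norm_le _ _) _.
    by rewrite -mulrA ler_pM2l // ler_wpM2r // Gle.
  by move: h2; rewrite !ler_norml; lra.
(* The Lipschitz bound on [G] follows from three expansions among [x], [y] and [x + v] with
   [|v| <= |x - y|]; as [|x - y| <= 8 * rho], the radius [12 * rho] leaves room for [x + v]. *)
have lipG x y : `|x - z| <= 4 * rho -> `|y - z| <= 4 * rho ->
    `|G x - G y| <= 6 * K * `|x - y|.
  move=> xz yz; set t := `|x - y|; have t0 : 0 <= t by exact: normr_ge0.
  have [xB yB] := (boxle _ _ le4 xz, boxle _ _ le4 yz).
  have t8 : t <= 8 * rho.
    rewrite /t -(subrKA z) (le_trans (ler_normD _ _)) //.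
    by move: xz yz; rewrite (distrC z y); lra.
  have key v : `|v| <= t -> dotp (G x - G y) v <= 6 * K * t ^+ 2.
    move=> vt.
    have xvB : eball 0 1 (x + v).
      by apply: box12; rewrite addrAC (le_trans (ler_normD _ _)) //; lra.
    have e1 := expand _ _ xvB xB; have e2 := expand _ _ xvB yB; have e3 := expand _ _ xB yB.
    rewrite (addrAC x v) subrr add0r in e1; rewrite (addrAC x v) dotpDr in e2.
    have v2 : K * `|v| ^+ 2 <= K * t ^+ 2 by rewrite ler_pM2l // lerXn2r ?nnegrE.
    have xv2 : K * `|x - y + v| ^+ 2 <= K * (2 * t) ^+ 2.
      rewrite ler_pM2l // lerXn2r ?nnegrE ?mulr_ge0 //.
      by rewrite (le_trans (ler_normD _ _)) // -/t; lra.
    rewrite dotpDl dotpNl; move: e1 e2 e3; rewrite -/t !ler_norml.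
    by move: xv2; rewrite exprMn; lra.
  have [t00|tn0] := eqVneq t 0.
    have : x - y = 0 by apply/normr0_eq0.
    by move/subr0_eq ->; rewrite subrr normr0 t00 mulr0.
  have tp : 0 < t by rewrite lt_neqAle eq_sym tn0.
  apply: norm_le => [|i]; first by rewrite mulr_ge0 // mulr_ge0 // ltW.
  have nd (b : R) : `|b| = t -> `|b *: delta_mx 0 i : 'rV[R]_n| <= t.
    move=> bt; rewrite normrZ bt -[leRHS]mulr1 ler_pM2l //.
    by apply: norm_le => // j; rewrite mxE eqxx /=; case: eqP => _; rewrite ?normr1 ?normr0.
  have := key _ (nd t (gtr0_norm tp)); have := key _ (nd (- t) _).
  rewrite normrN gtr0_norm // => /(_ erefl).
  rewrite !dotpZr !dotp_delta; set d := (G x - G y) 0 i => h1 h2.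
  suff : `|t * d| <= t * (6 * K * t) by rewrite normrM gtr0_norm // ler_pM2l.
  by rewrite ler_norml; move: h1 h2; rewrite !expr2; lra.
pose L := 6 * K + (2 * K + n%:R * (N + 8 * c)).
have nN0 : 0 < n%:R * (N + 8 * c) by rewrite mulr_gt0 // addr_gt0 // mulr_gt0.
have L0 : 0 < L by rewrite /L; lra.
have leL a b : a <= L -> 0 <= b -> a * b <= L * b by move=> aL b0; rewrite ler_wpM2r.
have cont_psi x : eball 0 1 x -> {for x, continuous psi}.
  move=> xB.
  have cs a : dotp (x' - a) (x' - a) @[x' --> x] --> dotp (x - a) (x - a).
    have c1 : x' - a @[x' --> x] --> x - a by exact: cvg_sub.
    exact: (cvg_dotp c1 c1).
  exact: (cvgD (cvgD (cont_phi x xB) (cvgMl_tmp (cs y0))) (cvgMl_tmp (cs z))).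
(* [m0 / 2] is a lower bound for the Euclidean norm of [G]; dividing by [n.+1] passes to the sup
   norm. *)
apply: (@no_strict_contact R n z rho L c u psi G rho0 L0 c0 _ _ _ _ _ _
  F (eta / 2) (m0 / (2 * n.+1%:R)) (Lam * n%:R)).
- move=> x y xz yz; apply: le_trans (expand _ _ (boxle _ _ le4 xz) (boxle _ _ le4 yz)) _.
  by apply: leL; rewrite ?sqr_ge0 // /L; lra.
- move=> x y xz yz; apply: le_trans (lip _ _ (boxle _ _ le4 xz) (boxle _ _ le4 yz)) _.
  by apply: leL => //; rewrite /L; lra.
- move=> x y xz yz; apply: le_trans (lipG _ _ xz yz) _.
  by apply: leL => //; rewrite /L; lra.
- move=> y yz; have := Hmax y yz; rewrite /psi subrr dotp0r mulr0.
  have : c * `|y - z| ^+ 2 <= c * dotp (y - z) (y - z) by rewrite ler_pM2l // norm_sqr_le.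
  by lra.
- by move=> x /(boxle _ _ le4); apply: cont_u.
- by move=> x /(boxle _ _ le4); apply: cont_psi.
- by rewrite divr_gt0.
- by rewrite divr_gt0 // mulr_gt0.
- by rewrite mulr_gt0.
- move=> y l X yz l0 Xs [r r0 H].
  have := subsol_jet sub_u (boxle _ _ le2 yz) Xs r0 H.
  rewrite /degenerate pmulr_rge0 // powR_gt0 //.
  by rewrite (lt_le_trans _ (norm_le_enorm _)) // normr_gt0.
- move=> x l X xz Xs [r r0 H].
  have xB := boxle _ _ le2 xz.
  have Ys : (X + (- (4 * c))%:M)^T = X + (- (4 * c))%:M by rewrite linearD /= Xs tr_scalar_mx.
  (* A jet of [psi] from below becomes one of [phi] once the two paraboloids are subtracted. *)
  have J : F x (X + (- (4 * c))%:M) <= - eta.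
    apply: (obstacle_jet xB (l := l - (2 * c) *: (x - y0) - (2 * c) *: (x - z)) Ys).
    exists r => // v /H h; have := shift x v.
    move: (x - y0) (x - z) => a b.
    by rewrite mulmxDr mul_mx_scalar !dotpDl !dotpNl !dotpZl; move: h; lra.
  have c40 : 0 <= 4 * c by rewrite mulr_ge0 // ltW.
  have := elliptic_shift n0 ellF xB Ys c40.
  rewrite -addrA -raddfD /= addNr raddf0 addr0.
  by move: c_eta J; lra.
- move=> b e e0; have [d d0 Hd] := coeff_continuous n0 b CF0 om cF F0 e0.
  by exists d => // x y X /(boxle _ _ le2) xB /(boxle _ _ le2) yB; apply: Hd.
- move=> x X t xz Xs t0; rewrite -mulrA.
  exact: (elliptic_shift n0 ellF (boxle _ _ le2 xz) Xs t0).
- move=> x xz; have xB : eball 0 1 x by apply: (boxle 1); rewrite ?mul1r ?ler1n.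
  have low := grad_lower_bound xB; rewrite -/m0 in low.
  have h1 : enorm (grad phi x) - enorm ((2 * c) *: (x - y0))
      <= enorm (grad phi x + (2 * c) *: (x - y0)).
    exact: enormD_ge.
  have h2 : enorm (grad phi x + (2 * c) *: (x - y0)) - enorm ((2 * c) *: (x - z))
      <= enorm (G x).
    exact: enormD_ge.
  rewrite !enormZ gtr0_norm ?mulr_gt0 // in h1 h2.
  have h3 : c * enorm (x - y0) <= c * 2 by rewrite ler_pM2l // dB.
  have h4 : c * enorm (x - z) <= c * 2 by rewrite ler_pM2l // dB.
  have h5 : m0 / 2 <= n.+1%:R * `|G x| by apply: (le_trans _ (enorm_le _)); lra.
  by rewrite ler_pdivrMr ?mulr_gt0 //; lra.
Qed.

End ObstacleEstimates.

(** * Growth at the free boundary *)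

Section Final.
Variables (R : realType) (n : nat).

(** A supremum equal to [-oo] means that [A] is empty, and then 0 serves because [b] is positive. *)
Lemma ereal_sup_lt_real (T : Type) (A : set T) (f : T -> R) (b : R) : 0 < b ->
  (ereal_sup [set (f x)%:E | x in A] < b%:E)%E ->
  exists2 s, s < b & forall x, A x -> f x <= s.
Proof.
move=> b0; set S := ereal_sup _ => Sb.
have ub x : A x -> ((f x)%:E <= S)%E by move=> Ax; apply: ereal_sup_ubound; exists x.
case: S Sb ub => [s| |] //; first by rewrite lte_fin => sb ub; exists s.
by move=> _ ub; exists 0 => // x /ub.
Qed.

Lemma free_boundary_near (phi u : 'rV[R]_n -> R) x0 (e : R) : 0 < e ->
  free_boundary phi u x0 ->
  exists y, [/\ `|y - x0| < e, eball 0 1 y & phi y < u y].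
Proof.
move=> e0 [_ [cl _]]; have [y [[yB yu] yx]] := cl _ (near_norm x0 e0).
by exists y.
Qed.

Lemma within_eball_continuous (w : 'rV[R]_n -> R) x :
  {within closure (eball 0 1), continuous w} -> eball 0 1 x -> {for x, continuous w}.
Proof.
move=> /(continuous_subspaceW (@subset_closure _ (eball 0 1))).
rewrite continuous_open_subspace; last exact: open_eball.
by move=> H xB; apply: H; apply: mem_set.
Qed.

End Final.

Unset Implicit Arguments.

(* N is the value of the C^{1,1}(B_1) norm of phi; c depends only on the
   parameters bound before it.  phi is a function on the closed ball, continuous
   up to the boundary, so that phi < g makes sense there. *)
Theorem theorem1p8 (R : realType) (n : nat) (lam Lam gamma CF : R)
    (omega : R -> R) (Upsilon N : R) :
  (1 <= n)%N -> 0 < lam -> lam <= Lam -> 0 < gamma -> 0 < CF ->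
  is_modulus omega -> 0 < Upsilon ->
  exists c : R, 0 < c /\
    forall (F : 'rV[R]_n -> 'M[R]_n -> R) (phi g u : 'rV[R]_n -> R),
      uniformly_elliptic lam Lam F ->
      coeff_modulus CF omega F ->
      (forall x, eball 0 1 x -> F x 0 = 0) ->
      ((forall x, eball 0 1 x -> convex_on_Sym (F x)) \/
       (forall x, eball 0 1 x -> concave_on_Sym (F x))) ->
      C11 (eball 0 1) phi ->
      C11norm (eball 0 1) phi = N%:E ->
      {within closure (eball 0 1), continuous phi} ->
      visc_supersol (degenerate gamma F) (fun=> - Upsilon) phi ->
      {within bdry (eball 0 1), continuous g} ->
      (forall x, bdry (eball 0 1) x -> phi x < g x) ->
      obstacle_sol F gamma phi g u ->
      (exists K : R, forall x, closure (eball 0 1) x -> `|u x| <= K) ->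
      forall x0 : 'rV[R]_n, (free_boundary phi u `&` eball 0 (2^-1)) x0 ->
      forall r : R, 0 < r -> r < 2^-1 ->
        ((c * r ^+ 2)%:E <=
           ereal_sup [set (u x - phi x)%:E | x in bdry (eball x0 r)])%E.
Proof.
move=> n0 lam0 lamLam gamma0 CF0 om Ups0.
have Lam0 : 0 < Lam by apply: lt_le_trans lamLam.
have n1 : 0 < n%:R :> R by rewrite ltr0n.
(* [c] is chosen before [N] is known to be a norm; [M] is a positive upper bound for it. *)
pose M := `|N| + 1; have M0 : 0 < M by rewrite ltr_wpDl.
have NM : N <= M by apply: le_trans (ler_norm N) _; rewrite lerDl.
pose m0 := (Upsilon / (2 * M * Lam * n%:R)) `^ gamma^-1.
have m00 : 0 < m0 by apply: powR_gt0; rewrite divr_gt0 ?mulr_gt0.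
pose eta := Upsilon / M `^ gamma.
have eta0 : 0 < eta by rewrite divr_gt0 // powR_gt0.
pose c := Num.min (m0 / 16) (eta / (8 * (Lam * n%:R))).
have c0 : 0 < c by rewrite lt_min; apply/andP; split; apply: divr_gt0 => //; rewrite !mulr_gt0.
have c_m : 16 * c <= m0 by rewrite mulrC -ler_pdivlMr // ge_min lexx.
have c_eta : 8 * (Lam * (n%:R * c)) <= eta.
  have : c * (8 * (Lam * n%:R)) <= eta by rewrite -ler_pdivlMr ?mulr_gt0 // ge_min lexx orbT.
  by lra.
exists c; split=> // F phi g u ellF cF F0 _ _ phiN phi_cont phi_super _ _ [u_cont [_ u_sub] _ _] _.
move=> x0 [x0_free x0_half] r r0 r_half; rewrite leNgt; apply/negP => Hsup.
have [grad_le expand] := C11norm_bounds n0 phiN.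
have grad_phi x : eball 0 1 x -> enorm (grad phi x) <= M by move=> /grad_le/le_trans; apply.
have expand_phi x y : eball 0 1 x -> eball 0 1 y ->
    `|phi x - phi y - dotp (grad phi y) (x - y)| <= M * enorm (x - y) ^+ 2.
  by move=> xB yB; apply: le_trans (expand x y xB yB) _; rewrite ler_wpM2r ?sqr_ge0.
have cr0 : 0 < c * r ^+ 2 by rewrite mulr_gt0 ?exprn_gt0.
have [s s_lt Hs] := ereal_sup_lt_real cr0 Hsup.
(* [y0] will be so near [x0] that on the sphere the paraboloid still exceeds [s]: in
   [c * (r - d) ^+ 2] the loss [2 * c * r * d] is at most half of [c * r ^+ 2 - s]. *)
pose d := Num.min (r / 2) ((c * r ^+ 2 - s) / (4 * (c * r))).
have ks : 0 < c * r ^+ 2 - s by rewrite subr_gt0.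
have d0 : 0 < d by rewrite lt_min; apply/andP; split; apply: divr_gt0; rewrite ?mulr_gt0.
have d_r : d <= r / 2 by rewrite ge_min lexx.
have d_s : d * (4 * (c * r)) <= c * r ^+ 2 - s.
  by rewrite -ler_pdivlMr ?mulr_gt0 // ge_min lexx orbT.
have d_n : 0 < d / n.+1%:R by rewrite divr_gt0.
have [y0 [y0x0 y0B y0u]] := free_boundary_near d_n x0_free.
have y0d : enorm (y0 - x0) <= d.
  by apply: le_trans (enorm_le _) _; rewrite mulrC -ler_pdivlMr // ltW.
have ballB x : enorm (x - x0) <= r -> eball 0 1 x.
  move=> xr; rewrite eball0E -(subrK x0 x) (le_lt_trans (enormD _ _)) //.
  by move: x0_half; rewrite /eball /= subr0; lra.
pose D x := u x - phi x - c * dotp (x - y0) (x - y0).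
have [|||z /= zr zmax] := @compact_max R _ [set x | enorm (x - x0) <= r] D.
- by exists x0; rewrite /= subrr /enorm dotp0l sqrtr0 ltW.
- exact: compact_eball_closed.
- move=> x /= /ballB xB.
  have c1 : x' - y0 @[x' --> x] --> x - y0 by exact: cvg_sub.
  have c2 : dotp (x' - y0) (x' - y0) @[x' --> x] --> dotp (x - y0) (x - y0).
    exact: (cvg_dotp c1 c1).
  have cu := within_eball_continuous u_cont xB.
  have cphi := within_eball_continuous phi_cont xB.
  exact: (cvgB (cvgB cu cphi) (cvgMl_tmp c2)).
have Dy0 : D y0 <= D z by apply: zmax; lra.
have Dpos : 0 < D z.
  by apply: lt_le_trans Dy0; rewrite /D subrr dotp0l mulr0 subr0 subr_gt0.
(* On the sphere [D] would be negative, whereas [D z >= D y0 > 0]. *)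
have zlt : eball x0 r z.
  rewrite /eball /= lt_neqAle zr andbT; apply/eqP => zE.
  have := Hs z (sphere_bdry r0 zE) => uz.
  have e1 : r - d <= enorm (z - y0).
    have := enormD_ge (z - x0) (x0 - y0); rewrite subrKA zE -(enormN (x0 - y0)) opprB.
    by lra.
  have e2 : (r - d) ^+ 2 <= dotp (z - y0) (z - y0).
    by rewrite -enorm_sqr ler_pXn2r ?nnegrE ?enorm_ge0 //; lra.
  have e3 : c * (r - d) ^+ 2 <= c * dotp (z - y0) (z - y0) by rewrite ler_pM2l.
  have e4 : 0 <= c * d ^+ 2 by rewrite mulr_ge0 ?sqr_ge0 // ltW.
  have e5 := mulr_gt0 d0 (mulr_gt0 c0 r0).
  by move: Dpos; rewrite /D; move: e3; rewrite sqrrB mulr2n; lra.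
have [rho rho0 Hrho] := eball_box zlt.
(* The division provides the margin [12 * rho'] around [z] required by [no_quadratic_contact]. *)
pose rho' := rho / 12; have rho'0 : 0 < rho' by rewrite divr_gt0.
have inball x : `|x - z| <= 12 * rho' -> enorm (x - x0) <= r.
  by rewrite /rho' mulrC divfK ?pnatr_eq0 // => /Hrho; rewrite /eball /= => /ltW.
apply: (@no_quadratic_contact R n lam Lam gamma Upsilon M F phi n0 Lam0 gamma0 Ups0 M0
  ellF F0 grad_phi expand_phi phi_super CF omega u c y0 z rho') => //.
- by move=> x; apply: within_eball_continuous.
- by move=> x; apply: within_eball_continuous.
- by move=> x /inball/ballB.
- by move=> y yz; apply: zmax; apply: inball; lra.
Qed.
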